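(* Let $W^B$ be a channel from $\mathcal X$ to $\mathcal Y$ and $W^E$ a channel from $\mathcal X$ to a finite set $\mathcal Z$. For any positive integers $L,M$, any reals $C,C'>0$, and any probability distribution $p$ on $\mathcal X$, there exists a wire-tap code $\Phi$ with $|\Phi|=M$ satisfying simultaneously $$\epsilon_B(\Phi)\le 3\min_{0\le s\le1}(ML)^s\sum_y\Big(\mathrm{E}_p\,W^B_x(y)^{1/(1+s)}\Big)^{1+s},$$ $$\epsilon_B(\Phi)\le 3\Big(\mathrm{E}_p\,W^B_x\Big\{y:\tfrac{W^B_x(y)}{W^B_p(y)}\le C'\Big\}+\frac{ML}{C'}\Big),$$ $$I_E(\Phi)\le 3\Big(\eta(\delta_{p,W^E,C})+\delta_{p,W^E,C}\log|\mathcal Z|+\frac{\delta'_{p,W^E,C}}{L}\Big),$$ $$I_E(\Phi)\le 3\min_{-1/2\le t<0}\frac{\log\big(1+L^te^{\phi(t|W^E,p)}\big)}{-t},$$ $$d_E(\Phi)\le 6\Big(2\delta_{p,W^E,C}+\sqrt{\frac{\delta'_{p,W^E,C}}{L}}\Big).$$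
   Context: A channel $W$ from a finite or countable set $\mathcal X$ to a finite or countable set $\mathcal Y$ is a map $x\mapsto W_x$ assigning a probability distribution $W_x$ on $\mathcal Y$; $W_p(y):=\sum_x p(x)W_x(y)$, $W_Q$ likewise for any distribution $Q$ on $\mathcal X$, and $\mathrm{E}_p$ is expectation over $x\sim p$. A wire-tap code for the pair $(W^B,W^E)$ is a triple $\Phi=(M,\{Q_1,\dots,Q_M\},\{\mathcal D_1,\dots,\mathcal D_M\})$ with $Q_i$ probability distributions on $\mathcal X$ and $\mathcal D_1,\dots,\mathcal D_M$ pairwise disjoint subsets of $\mathcal Y$; $|\Phi|:=M$. Its performance quantities: $\epsilon_B(\Phi):=\frac1M\sum_{i=1}^MW^B_{Q_i}(\mathcal D_i^c)$; $I_E(\Phi):=\sum_i\frac1M D(W^E_{Q_i}\|W^E_\Phi)$ with $W^E_\Phi:=\sum_i\frac1M W^E_{Q_i}$; $d_E(\Phi):=\frac{1}{M(M-1)}\sum_{i\neq j}d(W^E_{Q_i},W^E_{Q_j})$, where $d(q,r)=\sum_z|q(z)-r(z)|$ and $D(q\|r)=\sum q\log(q/r)$. Further, $\delta_{p,W,C}:=\sum_x p(x)\sum_{y:\,W_x(y)>CW_p(y)}W_x(y)$, $\delta'_{p,W,C}:=\sum_x p(x)\sum_{y:\,W_x(y)\le CW_p(y),\,W_p(y)>0}\frac{W_x(y)^2}{W_p(y)}$, $\phi(t|W,p):=\log\sum_y\big(\sum_xp(x)W_x(y)^{1/(1+t)}\big)^{1+t}$, $\eta(x):=-x\log x$. *)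

(* Defs.v *)
From HB Require Import structures.
From mathcomp Require Import all_boot all_order all_algebra.
From mathcomp Require Import all_classical all_reals all_analysis.
Set Implicit Arguments. Unset Strict Implicit. Unset Printing Implicit Defensive.
Import Order.TTheory GRing.Theory Num.Theory.
Local Open Scope classical_set_scope.
Local Open Scope ring_scope.

Section WireTap.
Variable R : realType.

Definition esumR {T : choiceType} (A : set T) (f : T -> R) : \bar R :=
  \esum_(x in A) (f x)%:E.
(* real value of such a sum (used only when the sum is known to be finite) *)
Definition sumR {T : choiceType} (A : set T) (f : T -> R) : R := fine (esumR A f).

Definition is_pdist {T : choiceType} (p : T -> R) : Prop :=
  (forall x, 0 <= p x) /\ esumR setT p = 1%E.

Definition is_channel {X Y : choiceType} (W : X -> Y -> R) : Prop :=
  forall x, is_pdist (W x).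

Definition mixW {X Y : choiceType} (W : X -> Y -> R) (Q : X -> R) (y : Y) : R :=
  sumR setT (fun x => Q x * W x y).
Definition mixWset {X Y : choiceType} (W : X -> Y -> R) (Q : X -> R) (A : set Y) : R :=
  sumR A (mixW W Q).

Definition eta_ent (x : R) : R := - (x * ln x).

(* relative entropy on a finite set (0 log 0 = 0) *)
Definition relent {Z : finType} (q r : Z -> R) : R := \sum_(z : Z) q z * ln (q z / r z).
Definition l1dist {Z : finType} (q r : Z -> R) : R := \sum_(z : Z) `|q z - r z|.

(* performance quantities of a wire-tap code (M, Q, D) *)
Definition epsB {X Y : choiceType} (WB : X -> Y -> R) (M : nat)
  (Q : 'I_M -> X -> R) (D : 'I_M -> set Y) : R :=
  (M%:R)^-1 * \sum_(i < M) mixWset WB (Q i) (~` D i).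

Definition WPhi {X : choiceType} {Z : finType} (WE : X -> Z -> R) (M : nat)
  (Q : 'I_M -> X -> R) (z : Z) : R :=
  \sum_(i < M) (M%:R)^-1 * mixW WE (Q i) z.

Definition IE {X : choiceType} {Z : finType} (WE : X -> Z -> R) (M : nat)
  (Q : 'I_M -> X -> R) : R :=
  \sum_(i < M) (M%:R)^-1 * relent (mixW WE (Q i)) (WPhi WE Q).

Definition dE {X : choiceType} {Z : finType} (WE : X -> Z -> R) (M : nat)
  (Q : 'I_M -> X -> R) : R :=
  ((M * (M - 1))%:R)^-1 *
  \sum_(i < M) \sum_(j < M | i != j) l1dist (mixW WE (Q i)) (mixW WE (Q j)).

Definition delta {X Y : choiceType} (p : X -> R) (W : X -> Y -> R) (C : R) : R :=
  sumR setT (fun x => p x * sumR [set y | C * mixW W p y < W x y] (W x)).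

Definition delta' {X Y : choiceType} (p : X -> R) (W : X -> Y -> R) (C : R) : R :=
  sumR setT (fun x => p x *
    sumR [set y | W x y <= C * mixW W p y /\ 0 < mixW W p y]
         (fun y => W x y ^+ 2 / mixW W p y)).

Definition Epow {X Y : choiceType} (W : X -> Y -> R) (p : X -> R) (s : R) (y : Y) : R :=
  sumR setT (fun x => p x * powR (W x y) (1 / (1 + s))).

(* sum_y (E_p W_x(y)^{1/(1+s)})^{1+s}, possibly +oo for countable Y *)
Definition gallager_sum {X Y : choiceType} (W : X -> Y -> R) (p : X -> R) (s : R) : \bar R :=
  esumR setT (fun y => powR (Epow W p s y) (1 + s)).

Definition phiW {X : choiceType} {Z : finType} (t : R) (W : X -> Z -> R) (p : X -> R) : R :=
  ln (\sum_(z : Z) powR (Epow W p t z) (1 + t)).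

End WireTap.

(* Main.v *)
(* Random coding: draw M * L codewords independently from p, let Q_i be uniform
   on the L codewords of message i, and decode by maximum likelihood.  Every
   Jensen inequality in the usual analysis is replaced by a tangent line whose
   slope is either constant or depends on a single codeword.  The quantities to
   average then become affine in products of functions of two codewords, so that
   only one- and two-point marginals of the code are ever needed and the
   expectation can be taken as an iterated sum over nonnegative extended reals.
   A Markov argument for three nonnegative variables (decoding error, divergence
   from W_p, L1 distance from W_p) yields one code meeting three times each of
   the averages; the other factor 2 for d_E is the triangle inequality through
   W_p. *)
Require Import Defs.
From HB Require Import structures.
From mathcomp Require Import all_boot all_order all_algebra.
From mathcomp Require Import all_classical all_reals all_analysis.
From mathcomp Require Import ring lra.
Import Order.TTheory GRing.Theory Num.Theory.
Local Open Scope classical_set_scope.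
Local Open Scope ring_scope.
Set Implicit Arguments.
Unset Strict Implicit.
Unset Printing Implicit Defensive.

(** * Expectation as an iterated sum *)

Section esum_extra.
Variable R : realType.
Local Open Scope ereal_scope.

(** Three random variables suffice for five bounds because the code and its decoder mention none of
    [s], [t], [C], [C']: each mean may have several upper bounds, and one code inherits them all.
    Divergence is measured from the fixed distribution W_p, because the code's own output mixture
    couples all messages; the mixture identity [relent_mixture_le] shows that this can only increase
    it. The tangent lines cost nothing. For an increasing concave f, the tangent at b has mean at
    most f(b) as soon as b dominates the mean of the argument, which is what Jensen would give. The
    tangent points are therefore means known in advance: N times the mean of W^(1/(1+t)) for the
    decoder, and 1 + W_x/(L W_p), a conditional mean given one codeword, for the divergence. For the
    L1 distance the point k W_p keeps a free scale k, optimized after averaging. Sums of nonnegative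
    extended reals allow no subtraction, so every affine bound is averaged with its negative terms
    moved to the other side. *)

Lemma esumZl (T : choiceType) (A : set T) (k : R) (f : T -> \bar R) :
  (0 <= k)%R -> (forall x, 0 <= f x) ->
  \esum_(x in A) (k%:E * f x) = k%:E * \esum_(x in A) f x.
Proof.
move=> k0 f0.
have sub (l : R) (g : T -> \bar R) : (0 <= l)%R -> (forall x, 0 <= g x) ->
    \esum_(x in A) (l%:E * g x) <= l%:E * \esum_(x in A) g x.
  move=> l0 g0; apply: ge_ereal_sup => _ [F [finF FA]] <-.
  rewrite -ge0_mule_fsumr//.
  apply: lee_wpmul2l; first by rewrite lee_fin.
  by apply: ereal_sup_ubound; exists F.
move: k0; rewrite le_eqVlt => /predU1P[<-|k0].
  by rewrite mul0e esum1// => i _; rewrite mul0e.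
apply/eqP; rewrite eq_le sub ?(ltW k0)//=.
rewrite -lee_pdivlMl//.
apply: le_trans (sub k^-1%R _ _ _); last 2 first.
  by rewrite invr_ge0 ltW.
  by move=> x; rewrite mule_ge0// lee_fin ltW.
apply: le_esum => x _.
by rewrite muleA -EFinM mulVf ?gt_eqF// mul1e.
Qed.

Lemma exchange_esum (T1 T2 : choiceType) (A : set T1) (B : set T2)
    (f : T1 -> T2 -> \bar R) : (forall x y, 0 <= f x y) ->
  \esum_(x in A) \esum_(y in B) f x y = \esum_(y in B) \esum_(x in A) f x y.
Proof.
move=> f0; rewrite !esum_esum//.
rewrite (reindex_esum (B `*`` fun=> A) _ (fun k => (k.2, k.1)))//.
split => [[x y] [] //|[x y] [x' y'] _ _ [-> ->]//|[x y] [? ?]].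
by exists (y, x).
Qed.

Lemma esum_finType (T : finType) (A : set T) (f : T -> \bar R) :
  (forall x, 0 <= f x) -> \esum_(x in A) f x = \sum_(x | x \in A) f x.
Proof.
move=> f0; rewrite esum_mkcond esum_fset; last 2 first.
- exact: finite_finset.
- by move=> i _; case: ifP.
rewrite [RHS]big_mkcond/= [RHS]fsbig_seq ?index_enum_uniq//.
suff -> : [set` index_enum T] = setT by [].
by rewrite predeqE => x; split => // _; exact: mem_index_enum.
Qed.

Lemma esum_set1T (T : choiceType) (x0 : T) (f : T -> \bar R) : 0 <= f x0 ->
  (forall x, x != x0 -> f x = 0) -> \esum_(x in setT) f x = f x0.
Proof.
move=> f0 fN; rewrite -(esum_set1 f0) esum_mkcond [RHS]esum_mkcond.
apply: eq_esum => x _; rewrite in_setT; case: ifPn => //.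
by rewrite in_set1 => /fN.
Qed.

End esum_extra.

(** * Expectation over one letter drawn from [p] *)

Section Expectation.
Variables (R : realType) (X : choiceType) (p : X -> R).
Hypothesis p_dist : is_pdist p.
Local Open Scope ereal_scope.
Implicit Types f g : X -> \bar R.

Let p0 x : (0 <= p x)%R. Proof. by case: p_dist. Qed.
Let pE0 x : 0 <= (p x)%:E. Proof. by rewrite lee_fin. Qed.

Definition Ex f := \esum_(x in setT) ((p x)%:E * f x).

Lemma Ex_ge0 f : (forall x, 0 <= f x) -> 0 <= Ex f.
Proof. by move=> f0; apply: esum_ge0 => x _; rewrite mule_ge0. Qed.

Lemma le_Ex f g : (forall x, (0 < p x)%R -> f x <= g x) -> Ex f <= Ex g.
Proof.
move=> fg; apply: le_esum => x _.
have := p0 x; rewrite le_eqVlt => /predU1P[<-|px]; first by rewrite !mul0e.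
by apply: lee_wpmul2l => //; exact: fg.
Qed.

Lemma eq_Ex f g : (forall x, (0 < p x)%R -> f x = g x) -> Ex f = Ex g.
Proof. by move=> fg; apply/eqP; rewrite eq_le !le_Ex// => x /fg ->. Qed.

Lemma ExD f g : (forall x, 0 <= f x) -> (forall x, 0 <= g x) ->
  Ex (fun x => f x + g x) = Ex f + Ex g.
Proof.
move=> f0 g0; rewrite -esumD; do ?by move=> x _; rewrite mule_ge0.
by apply: eq_esum => x _; rewrite ge0_muleDr.
Qed.

Lemma ExZ (k : R) f : (0 <= k)%R -> (forall x, 0 <= f x) ->
  Ex (fun x => k%:E * f x) = k%:E * Ex f.
Proof.
move=> k0 f0; rewrite -esumZl//; last by move=> x; rewrite mule_ge0.
by apply: eq_esum => x _; rewrite muleCA.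
Qed.

Lemma Ex_cst (k : \bar R) : 0 <= k -> Ex (fun=> k) = k.
Proof.
have E1 : Ex (fun=> 1) = 1.
  by rewrite -[RHS](p_dist.2); apply: eq_esum => x _; rewrite mule1.
case: k => [r r0| _|//].
  transitivity (Ex (fun=> r%:E * 1)); first by rewrite mule1.
  by rewrite ExZ// E1 mule1.
apply/eqP; rewrite eq_le leey/= leye_eq; apply/eqP/eqyP => A A0.
apply: le_trans (_ : Ex (fun=> A%:E * 1) <= _).
  by rewrite ExZ ?E1 ?mule1// ltW.
by apply: le_Ex => x _; rewrite leey.
Qed.

Lemma Ex_esum (T : choiceType) (A : set T) (f : T -> X -> \bar R) :
  (forall t x, 0 <= f t x) ->
  Ex (fun x => \esum_(t in A) f t x) = \esum_(t in A) Ex (f t).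
Proof.
move=> f0; rewrite -exchange_esum//; last by move=> *; rewrite mule_ge0.
by apply: eq_esum => x _; rewrite esumZl.
Qed.

Lemma exchange_Ex (h : X -> X -> \bar R) : (forall x y, 0 <= h x y) ->
  Ex (fun x => Ex (h^~ x)) = Ex (fun x => Ex (h x)).
Proof.
move=> h0.
transitivity (\esum_(x in [set: X]) \esum_(y in [set: X])
    ((p x)%:E * ((p y)%:E * h y x))).
  by apply: eq_esum => x _; rewrite esumZl// => y; exact: mule_ge0.
rewrite exchange_esum; last by move=> x y; rewrite !mule_ge0.
apply: eq_esum => x _; rewrite -esumZl//; last by move=> y; exact: mule_ge0.
by apply: eq_esum => y _; rewrite muleCA.
Qed.

(** Strictness survives an infinite sum because a single atom [x0] of positive mass keeps a definite
    excess: if f exceeded [a] on the whole support, the mean would be at least a + p(x0) e for some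
    e > 0. *)
Lemma Ex_le_witness f (a : R) : (forall x, 0 <= f x) -> Ex f <= a%:E ->
  exists x, (0 < p x)%R /\ f x <= a%:E.
Proof.
move=> f0 fa; apply: contrapT => noX.
have fgt x : (0 < p x)%R -> a%:E < f x.
  by move=> px; rewrite ltNge; apply/negP => fxa; apply: noX; exists x.
have [x0 px0] : exists x, (0 < p x)%R.
  apply: contrapT => no0; have := p_dist.2; rewrite /esumR esum1.
    by move=> /eqP; rewrite eq_sym onee_eq0.
  move=> x _; congr EFin; apply/eqP; rewrite eq_le p0 andbT leNgt.
  by apply/negP => px; apply: no0; exists x.
have a0 : 0 <= a%:E by apply: le_trans fa; exact: Ex_ge0.
have [e e0 ae] : exists2 e : R, (0 < e)%R & a%:E + e%:E <= f x0.
  have := fgt _ px0; case: (f x0) => [r|_|//].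
  - by rewrite lte_fin => ar; exists (r - a)%R; rewrite ?subr_gt0// -EFinD lee_fin; lra.
  - by exists 1%R; rewrite ?ltr01// leey.
have : Ex (fun x => a%:E + (if x == x0 then e else 0)%:E) <= Ex f.
  apply: le_Ex => x px; case: eqP => [->//|_]; rewrite adde0.
  exact/ltW/fgt.
have ind0 x : 0 <= (if x == x0 then e else 0)%:E.
  by case: ifP => _; rewrite lee_fin// ltW.
have Eind : Ex (fun x => (if x == x0 then e else 0)%:E) = (p x0 * e)%:E.
  rewrite /Ex (@esum_set1T _ _ x0) ?eqxx//; first by rewrite lee_fin mulr_ge0// ltW.
  by move=> x /negbTE ->; rewrite mule0.
rewrite ExD// Ex_cst// Eind => /le_trans/(_ fa); rewrite -EFinD lee_fin => h.
by have := mulr_gt0 px0 e0; lra.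
Qed.

Lemma Ex_le0 f x : (forall x, 0 <= f x) -> Ex f <= 0 -> (0 < p x)%R -> f x = 0.
Proof.
move=> f0 E0 px; apply/eqP; rewrite eq_le f0 andbT.
rewrite -(pmule_rle0 _ (x := (p x)%:E)) ?lte_fin//.
apply: le_trans E0; rewrite /Ex (esumID [set x]) ?setTI//; last first.
  by move=> y _; rewrite mule_ge0.
rewrite esum_set1 ?mule_ge0// leeDl// esum_ge0// => y _; exact: mule_ge0.
Qed.

(** * Expectation over independently drawn codewords *)

Section Product.
Variables (K : eqType) (x0 : X).
Hypothesis px0 : (0 < p x0)%R.
Implicit Types (F G : (K -> X) -> \bar R) (s : seq K).

Definition upd (c : K -> X) (k : K) (x : X) : K -> X :=
  fun k' => if k' == k then x else c k'.

(* Expectation of F when the coordinates in s are drawn independently from p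
   and the other ones are frozen at x0. *)
Fixpoint Ep s F : \bar R :=
  if s is k :: s' then Ex (fun x => Ep s' (fun c => F (upd c k x)))
  else F (fun=> x0).

Definition supported (c : K -> X) := forall k, (0 < p (c k))%R.

Lemma supported_upd c k x : supported c -> (0 < p x)%R -> supported (upd c k x).
Proof. by move=> sc px k'; rewrite /upd; case: ifP. Qed.

Lemma Ep_ge0 s F : (forall c, 0 <= F c) -> 0 <= Ep s F.
Proof. by elim: s F => //= k s IH F F0; apply: Ex_ge0 => x; exact: IH. Qed.

Lemma le_Ep s F G : (forall c, supported c -> F c <= G c) -> Ep s F <= Ep s G.
Proof.
elim: s F G => [|k s IH] F G FG /=; first by apply: FG => k.
by apply: le_Ex => x px; apply: IH => c sc; apply: FG; exact: supported_upd.
Qed.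

Lemma eq_Ep s F G : (forall c, supported c -> F c = G c) -> Ep s F = Ep s G.
Proof. by move=> FG; apply/eqP; rewrite eq_le !le_Ep// => c /FG ->. Qed.

Lemma EpD s F G : (forall c, 0 <= F c) -> (forall c, 0 <= G c) ->
  Ep s (fun c => F c + G c) = Ep s F + Ep s G.
Proof.
elim: s F G => //= k s IH F G F0 G0; rewrite -ExD; do ?by move=> x; exact: Ep_ge0.
by apply: eq_Ex => x _; rewrite IH.
Qed.

Lemma EpZ s (a : R) F : (0 <= a)%R -> (forall c, 0 <= F c) ->
  Ep s (fun c => a%:E * F c) = a%:E * Ep s F.
Proof.
move=> a0; elim: s F => //= k s IH F F0; rewrite -ExZ//; last by move=> x; exact: Ep_ge0.
by apply: eq_Ex => x _; rewrite IH.
Qed.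

Lemma Ep_cst s (a : \bar R) : 0 <= a -> Ep s (fun=> a) = a.
Proof. by move=> a0; elim: s => //= k s ->; rewrite Ex_cst. Qed.

Lemma Ep_esum s (T : choiceType) (A : set T) (F : T -> (K -> X) -> \bar R) :
  (forall t c, 0 <= F t c) ->
  Ep s (fun c => \esum_(t in A) F t c) = \esum_(t in A) Ep s (F t).
Proof.
elim: s F => //= k s IH F F0; rewrite -Ex_esum; last by move=> *; exact: Ep_ge0.
by apply: eq_Ex => x _; rewrite IH.
Qed.

Lemma Ep_sum s (I : Type) (r : seq I) (P : pred I) (F : I -> (K -> X) -> \bar R) :
  (forall i c, 0 <= F i c) ->
  Ep s (fun c => \sum_(i <- r | P i) F i c) = \sum_(i <- r | P i) Ep s (F i).
Proof.
move=> F0; elim: r => [|i r IH].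
  by rewrite big_nil -[RHS](Ep_cst s)//; apply: eq_Ep => c _; rewrite big_nil.
rewrite big_cons -IH; case: ifPn => Pi.
  rewrite -EpD//; last by move=> c; exact: sume_ge0.
  by apply: eq_Ep => c _; rewrite big_cons Pi.
by apply: eq_Ep => c _; rewrite big_cons (negbTE Pi).
Qed.

Lemma Ep_marginal s k f : uniq s -> k \in s -> (forall x, 0 <= f x) ->
  Ep s (fun c => f (c k)) = Ex f.
Proof.
move=> + + f0; elim: s => //= k' s IH /andP[k's us].
rewrite in_cons /upd; case: eqVneq => [_ _|_ /= ks].
  by apply: eq_Ex => x _; rewrite Ep_cst.
by rewrite IH// Ex_cst//; exact: Ex_ge0.
Qed.

Lemma Ep_marginal2 s k l (h : X -> X -> \bar R) : uniq s -> k \in s -> l \in s ->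
  k != l -> (forall x y, 0 <= h x y) ->
  Ep s (fun c => h (c k) (c l)) = Ex (fun x => Ex (h x)).
Proof.
move=> + + + kl h0; elim: s => //= k' s IH /andP[k's us].
rewrite !in_cons /upd; have [kk'|_] := eqVneq k k' => /=.
  have lk' : (l == k') = false by rewrite -kk' eq_sym (negbTE kl).
  rewrite lk' => _ /= ls.
  by apply: eq_Ex => x _; rewrite (Ep_marginal (f := h x)).
move=> ks; case: eqVneq => [_ _|_ /= ls].
  (* Here [l] is drawn before [k], so the two expectations come in the opposite order and Tonelli
     swaps them. *)
  transitivity (Ex (fun x => Ex (fun x' => h x' x))).
    by apply: eq_Ex => x _; rewrite (Ep_marginal (f := h^~ x)).
  exact: exchange_Ex.
by rewrite IH// Ex_cst//; apply: Ex_ge0 => x; exact: Ex_ge0.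
Qed.

(** [G] collects the variables of mean 0, which Markov's inequality cannot normalize; at each draw
    [Ex_le0] passes the vanishing of the mean on to every letter of positive mass. *)
Lemma Ep_le_witness s F G (a : R) : (forall c, 0 <= F c) -> (forall c, 0 <= G c) ->
  Ep s F <= a%:E -> Ep s G <= 0 -> exists c, [/\ supported c, F c <= a%:E & G c = 0].
Proof.
elim: s F G => [|k s IH] F G F0 G0 /=.
  by move=> Fa Ga; exists (fun=> x0); split => //; apply/eqP; rewrite eq_le Ga G0.
move=> /Ex_le_witness[|x [px Fx] EG]; first by move=> x; exact: Ep_ge0.
have Gx : Ep s (fun c => G (upd c k x)) <= 0.
  by rewrite (Ex_le0 _ EG px)// => y; exact: Ep_ge0.
have [c [sc Fc Gc]] := IH _ _ (fun c => F0 (upd c k x)) (fun c => G0 (upd c k x)) Fx Gx.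
by exists (upd c k x); split => //; exact: supported_upd.
Qed.

(** The sum of the ratios F_i / (n E F_i) has mean at most 1, hence is at most 1 at some code, and
    then so is each ratio. *)
Lemma markov_simultaneous s n (F : 'I_n -> (K -> X) -> \bar R) : (0 < n)%N ->
  (forall i c, 0 <= F i c) ->
  exists2 c, supported c & forall i, F i c <= n%:R%:E * Ep s (F i).
Proof.
move=> n0 F0; have nR : (0 < n%:R :> R)%R by rewrite ltr0n.
(* Since [fine] sends +oo to 0 and 0 is its own inverse, variables of mean 0 or +oo get weight 0.
   The former are forced to vanish through the second functional of [Ep_le_witness]; for the latter
   the claim is trivial. *)
pose b i := (n%:R * fine (Ep s (F i)))^-1%R.
have b0 i : (0 <= b i)%R.
  by rewrite invr_ge0 mulr_ge0 ?(ltW nR)// fine_ge0// Ep_ge0.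
have [c [sc Tc Gc]] : exists c, [/\ supported c,
    \sum_i ((b i)%:E * F i c) <= 1%R%:E & \sum_(i | Ep s (F i) == 0) F i c = 0].
  apply: (@Ep_le_witness s).
  - by move=> c; apply: sume_ge0 => i _; rewrite mule_ge0// lee_fin.
  - by move=> c; exact: sume_ge0.
  - rewrite Ep_sum; last by move=> i c; rewrite mule_ge0// lee_fin.
    apply: (@le_trans _ _ (\sum_(i < n) (n%:R^-1)%:E)).
      apply: lee_sum => i _; rewrite EpZ//.
      rewrite /b; have := Ep_ge0 s (F0 i); case: (Ep s (F i)) => [r|_|//].
      + rewrite -EFinM !lee_fin /= invfM -mulrA.
        have [->|r0 _] := eqVneq r 0%R; first by move=> _; rewrite !mulr0 invr_ge0 ltW.
        by rewrite mulVf ?mulr1.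
      + by rewrite /= mulr0 invr0 mul0e lee_fin invr_ge0 ltW.
    rewrite sumEFin sumr_const card_ord -[X in (X <= _)]/((_ *+ n)%:E) lee_fin.
    by rewrite -[(_^-1 *+ n)%R]mulr_natl mulfV// gt_eqF.
  - by rewrite Ep_sum// big1// => i /eqP.
exists c => // i.
case Ei : (Ep s (F i)) (Ep_ge0 s (F0 i)) => [r||//]; last first.
  by move=> _; rewrite mulry gtr0_sg// mul1e leey.
rewrite lee_fin le_eqVlt => /predU1P[r0|r0].
  rewrite -r0 mule0 -Gc (bigD1 i)/=; last by rewrite Ei -r0.
  by rewrite leeDl// sume_ge0.
have : (b i)%:E * F i c <= 1%R%:E.
  apply: le_trans Tc; rewrite [leRHS](bigD1 i)//= leeDl// sume_ge0// => j _.
  by rewrite mule_ge0// lee_fin.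
by rewrite /b Ei/= -EFinM lee_pdivrMl ?mulr_gt0// mule1.
Qed.

End Product.
End Expectation.

(** * Tangent-line inequalities *)

Section Inequalities.
Variable R : realType.
Implicit Types a b s u v y w : R.

Lemma ln_le_tangent a b : 0 < a -> 0 < b -> ln a <= ln b + a / b - 1.
Proof.
move=> a0 b0; have ab0 : 0 < a / b by rewrite divr_gt0.
have : ln (1 + (a / b - 1)) <= a / b - 1 by apply: le_ln1Dx; lra.
by rewrite addrC subrK ln_div ?posrE//; lra.
Qed.

Lemma powR_amgm u v s : 0 <= u -> 0 <= v -> 0 <= s <= 1 ->
  u `^ s * v `^ (1 - s) <= s * u + (1 - s) * v.
Proof.
move=> u0 v0 /andP[s0 s1].
have rhs0 : 0 <= s * u + (1 - s) * v by rewrite addr_ge0// mulr_ge0// subr_ge0.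
have [u_eq0|un0] := eqVneq u 0.
  have [->|sn0] := eqVneq s 0.
    by rewrite powRr0 mul1r subr0 powRr1// mul0r mul1r add0r.
  by rewrite {1}u_eq0 powR0// mul0r.
have [v_eq0|vn0] := eqVneq v 0.
  have [s_eq1|sn1] := eqVneq (1 - s) 0.
    have -> : s = 1 by lra.
    by rewrite subrr powRr0 mulr1 powRr1// mul0r mul1r addr0.
  by rewrite {1}v_eq0 powR0// mulr0.
have up : 0 < u by rewrite lt_neqAle eq_sym un0.
have vp : 0 < v by rewrite lt_neqAle eq_sym vn0.
set m := s * u + (1 - s) * v.
have m0 : 0 < m.
  rewrite lt_neqAle rhs0 andbT eq_sym; apply/eqP; rewrite /m => h.
  have := mulr_ge0 s0 u0; have := mulr_ge0 (_ : 0 <= 1 - s) v0.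
  move=> /(_ ltac:(lra)) h1 h2.
  have /eqP : s * u = 0 by lra.
  have /eqP : (1 - s) * v = 0 by lra.
  by rewrite !mulf_eq0 (negbTE un0) (negbTE vn0) !orbF => /eqP ? /eqP ?; lra.
rewrite /powR (negbTE un0) (negbTE vn0) -expRD -[leRHS]lnK ?posrE// ler_expR.
(* Both tangents of [ln] touch at the weighted mean [m], so their linear terms add up to s u/m + (1
   - s) v/m = 1 and cancel. *)
have h1 := ln_le_tangent up m0; have h2 := ln_le_tangent vp m0.
have h3 := ler_wpM2l s0 h1.
have h4 := ler_wpM2l (_ : 0 <= 1 - s) h2; move: h4 => /(_ ltac:(lra)) h4.
have e : s * (u / m) + (1 - s) * (v / m) = 1.
  by rewrite !mulrA -mulrDl -/m divff// gt_eqF.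
by move: h3 h4 e; clear; lra.
Qed.

Lemma powR_le_tangent y b s : 0 <= y -> 0 < b -> 0 <= s <= 1 ->
  y `^ s <= b `^ s * (1 - s + s * (y / b)).
Proof.
move=> y0 b0 s01.
have yb : 0 <= y / b by rewrite divr_ge0// ltW.
have := powR_amgm yb (ler01 : 0 <= 1 :> R) s01.
rewrite powR1 !mulr1 => h; have e : y = b * (y / b) by rewrite mulrC divfK// gt_eqF.
rewrite [in leLHS]e powRM// ?(ltW b0)// ler_wpM2l ?powR_ge0//.
by rewrite addrC.
Qed.

(** This is (1 + u)^s <= 1 + u^s: the fractions 1/(1+u) and u/(1+u) add up to 1, and each lies below
    its own s-th power. *)
Lemma ln1D_le_powR u s : 0 <= u -> 0 < s <= 1 -> ln (1 + u) <= ln (1 + u `^ s) / s.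
Proof.
move=> u0 /andP[s0 s1]; rewrite ler_pdivlMr// mulrC -ln_powR.
have u1 : 0 < 1 + u by lra.
rewrite ler_ln ?posrE ?powR_gt0 ?ltr_pwDl ?powR_ge0//.
have half x : 0 <= x <= 1 -> x <= x `^ s.
  move=> /andP[x0 x1]; have [->|xn0] := eqVneq x 0; first exact: powR_ge0.
  by apply: ger1_powR; rewrite ?s1// x1 andbT lt_neqAle eq_sym xn0.
have h1 : (1 + u)^-1 <= ((1 + u)^-1) `^ s.
  by apply: half; rewrite invr_ge0 (ltW u1) invf_le1//; lra.
have h2 : u / (1 + u) <= (u / (1 + u)) `^ s.
  by apply: half; rewrite divr_ge0 ?(ltW u1)//= ler_pdivrMr//; lra.
have h3 : 1 <= (1 + u)^-1 `^ s + (u / (1 + u)) `^ s.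
  by apply: le_trans (lerD h1 h2); rewrite -[X in X + _]mul1r -mulrDl divff// gt_eqF.
have := ler_wpM2l (powR_ge0 (1 + u) s) h3.
rewrite mulr1 mulrDr -!powRM ?invr_ge0 ?divr_ge0 ?(ltW u1)//.
by rewrite divff ?gt_eqF// powR1 mulrCA divff ?gt_eqF// mulr1.
Qed.

(** The correction -a + b cancels when summed over two distributions; it makes each summand of a
    relative entropy nonnegative, as averaging term by term requires. *)
Lemma relent_term_ge0 a b : 0 <= a -> 0 < b -> 0 <= a * ln (a / b) - a + b.
Proof.
rewrite le_eqVlt => /predU1P[<- b0|a0 b0]; first by rewrite mul0r subrr add0r ltW.
have := ln_le_tangent b0 a0; rewrite ln_div ?posrE// => h.
have := ler_wpM2l (ltW a0) h.
rewrite -[leRHS]/(a * (ln a + b / a - 1)).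
have -> : a * (ln a + b / a - 1) = a * ln a + b - a by field; rewrite gt_eqF.
by lra.
Qed.

(** As a <= w, the left side is at most the entropy of [a], and among measures of total mass d on Z
    the uniform one has the largest entropy. *)
Lemma sum_entropy_bound (Z : finType) (a w : Z -> R) :
  (0 < #|Z|)%N -> (forall z, 0 <= a z <= w z) ->
  \sum_z a z * (- ln (w z)) <=
    eta_ent (\sum_z a z) + (\sum_z a z) * ln (#|Z|%:R).
Proof.
move=> Z0 aw; set d := \sum_z a z; have n0 : 0 < #|Z|%:R :> R by rewrite ltr0n.
have a0 z : 0 <= a z by case/andP: (aw z).
have : 0 <= d by exact: sumr_ge0.
rewrite le_eqVlt => /predU1P[d0|d0].
  rewrite -d0 /eta_ent !mul0r oppr0 addr0 big1// => z _.
  have /eqP := esym d0; rewrite /d psumr_eq0// => /allP/(_ z).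
  by rewrite mem_index_enum => /(_ isT)/= /eqP ->; rewrite mul0r.
(* Tangent of [ln] at a(z), evaluated at the uniform value d/|Z|; summed over z, the terms -a(z) and
   d/|Z| cancel. *)
have step z : a z * (- ln (w z)) <= a z * (ln #|Z|%:R - ln d - 1) + d / #|Z|%:R.
  have := a0 z; rewrite le_eqVlt => /predU1P[<-|az0].
    by rewrite !mul0r add0r divr_ge0// ltW.
  have wz0 : 0 < w z by apply: lt_le_trans az0 _; case/andP: (aw z).
  have lnaw : ln (a z) <= ln (w z) by rewrite ler_ln ?posrE//; case/andP: (aw z).
  have dn0 : 0 < d / #|Z|%:R by rewrite divr_gt0.
  have := ln_le_tangent dn0 az0; rewrite ln_div ?posrE// => h.
  have h1 : - ln (w z) <= ln #|Z|%:R - ln d - 1 + d / #|Z|%:R / a z by lra.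
  have := ler_wpM2l (ltW az0) h1; rewrite mulrDr => /le_trans; apply.
  by rewrite lerD2l mulrC divfK// gt_eqF.
apply: (le_trans (ler_sum _ (fun z _ => step z))).
rewrite big_split/= -mulr_suml -/d sumr_const -[(d / _) *+ _]mulr_natr divfK ?gt_eqF//.
by rewrite /eta_ent; lra.
Qed.

(** The tangent of the square root at b^2: it stands for E|a| <= sqrt(E a^2) while staying affine in
    a^2, with b still free. *)
Lemma normr_le_amgm a b : 0 < b -> `|a| <= a ^+ 2 / (2 * b) + b / 2.
Proof.
move=> b0; rewrite -real_normK ?num_real// -subr_ge0; set t := `|a|.
have -> : t ^+ 2 / (2 * b) + b / 2 - t = (t - b) ^+ 2 / (2 * b).
  by field; rewrite gt_eqF.
by rewrite divr_ge0 ?sqr_ge0// mulr_ge0// ltW.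
Qed.

(** Compensation identity: the averaged divergence from [w] exceeds the averaged divergence from the
    mixture r by exactly D(r||w) >= 0. *)
Lemma relent_mixture_le (Z : finType) n (q : 'I_n -> Z -> R) (w : Z -> R) :
  (0 < n)%N -> (forall i z, 0 <= q i z) -> (forall i, \sum_z q i z = 1) ->
  (forall z, 0 <= w z) -> \sum_z w z = 1 -> (forall i z, w z = 0 -> q i z = 0) ->
  \sum_(i < n) n%:R^-1 * relent (q i) (fun z => \sum_(j < n) n%:R^-1 * q j z) <=
  \sum_(i < n) n%:R^-1 * relent (q i) w.
Proof.
move=> n0 q0 q1 w0 w1 qw; pose r z := \sum_(j < n) n%:R^-1 * q j z; rewrite -/r.
have nR : 0 < n%:R :> R by rewrite ltr0n.
have nV : 0 < n%:R^-1 :> R by rewrite invr_gt0.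
have r0 z : 0 <= r z by apply: sumr_ge0 => i _; rewrite mulr_ge0// ltW.
have r1 : \sum_z r z = 1.
  rewrite exchange_big/=; under eq_bigr do rewrite -mulr_sumr q1 mulr1.
  by rewrite sumr_const card_ord -[_ *+ n]mulr_natr mulVf// gt_eqF.
have -> : \sum_(i < n) n%:R^-1 * relent (q i) w =
    \sum_(i < n) n%:R^-1 * relent (q i) r + \sum_z r z * ln (r z / w z).
  under [X in _ + X]eq_bigr do rewrite mulr_suml.
  rewrite exchange_big/= -big_split/=; apply: eq_bigr => i _.
  under [X in _ + X]eq_bigr do rewrite -mulrA.
  rewrite -mulr_sumr -mulrDr; congr (_ * _).
  rewrite /relent -big_split/=; apply: eq_bigr => z _; rewrite -mulrDr.
  have := q0 i z; rewrite le_eqVlt => /predU1P[<-|qz]; first by rewrite !mul0r.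
  have wz : 0 < w z.
    rewrite lt_neqAle w0 andbT eq_sym; apply/eqP => /(qw i) h.
    by rewrite h ltxx in qz.
  have rz : 0 < r z.
    rewrite /r (bigD1 i)//= ltr_pwDl ?mulr_gt0//.
    by apply: sumr_ge0 => j _; rewrite mulr_ge0// ltW.
  by congr (_ * _); rewrite !ln_div ?posrE//; lra.
rewrite lerDl.
have -> : \sum_z r z * ln (r z / w z) = \sum_z (r z * ln (r z / w z) - r z + w z).
  by rewrite big_split/= sumrB r1 w1 subrK.
apply: sumr_ge0 => z _.
have := w0 z; rewrite le_eqVlt => /predU1P[wz|wz]; last exact: relent_term_ge0.
by rewrite /r big1 ?mul0r -?wz ?subrr ?addr0// => i _; rewrite qw ?mulr0.
Qed.

End Inequalities.

(** * Averages of bounded functions *)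

Section BoundedNonneg.
Variables (R : realType) (T : Type).
Implicit Types f g : T -> R.

(** On such functions the extended mean is finite and additive, so the real number [avg] loses
    nothing; the class is closed under sums, products and truncations, but not under differences. *)
Definition bnn f := exists B, forall t, 0 <= f t <= B.

Lemma bnn_ge0 f t : bnn f -> 0 <= f t.
Proof. by move=> [B /(_ t)/andP[]]. Qed.

Lemma bnn_cst a : 0 <= a -> bnn (fun=> a).
Proof. by move=> a0; exists a => t; rewrite a0 lexx. Qed.

Lemma bnnD f g : bnn f -> bnn g -> bnn (fun t => f t + g t).
Proof.
move=> [B fB] [C gC]; exists (B + C) => t.
by have := fB t; have := gC t; move=> /andP[? ?] /andP[? ?]; apply/andP; split; lra.
Qed.

Lemma bnnM f g : bnn f -> bnn g -> bnn (fun t => f t * g t).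
Proof.
move=> [B fB] [C gC]; exists (B * C) => t.
have /andP[f0 f1] := fB t; have /andP[g0 g1] := gC t.
by rewrite mulr_ge0//= ler_pM.
Qed.

Lemma bnnZ a f : 0 <= a -> bnn f -> bnn (fun t => a * f t).
Proof. by move=> a0; apply: bnnM; exact: bnn_cst. Qed.

Lemma bnn_sum (I : Type) (r : seq I) (P : pred I) (F : I -> T -> R) :
  (forall i, bnn (F i)) -> bnn (fun t => \sum_(i <- r | P i) F i t).
Proof.
move=> F0; elim: r => [|i r [B hB]].
  by exists 0 => t; rewrite big_nil lexx.
have [C hC] := F0 i; exists (C + B) => t; rewrite big_cons.
have /andP[? ?] := hC t; have /andP[? ?] := hB t.
by case: ifP => _; apply/andP; split; lra.
Qed.

Lemma bnn_if (P : pred T) f : bnn f -> bnn (fun t => if P t then f t else 0).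
Proof.
move=> [B fB]; exists B => t; have /andP[f0 f1] := fB t.
by case: ifP; rewrite ?f0// lexx (le_trans f0).
Qed.

End BoundedNonneg.

(** * Real-valued means, common to one letter and to a whole code *)

Section MeanFunctional.
Variables (R : realType) (T : Type) (S : T -> Prop) (E : (T -> \bar R) -> \bar R).
Implicit Types f g : T -> R.

Record averaging : Prop := Averaging {
  averaging_le : forall f g : T -> \bar R,
    (forall t, S t -> f t <= g t)%E -> (E f <= E g)%E;
  averagingD : forall f g : T -> \bar R,
    (forall t, 0 <= f t)%E -> (forall t, 0 <= g t)%E ->
    E (fun t => f t + g t)%E = (E f + E g)%E;
  averagingZ : forall (a : R) (f : T -> \bar R), 0 <= a ->
    (forall t, 0 <= f t)%E -> E (fun t => a%:E * f t)%E = (a%:E * E f)%E;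
  averaging_cst : forall a : \bar R, (0 <= a)%E -> E (fun=> a) = a }.

Definition avg f : R := fine (E (fun t => (f t)%:E)).

Hypothesis hE : averaging.

Lemma avgE f : bnn f -> E (fun t => (f t)%:E) = (avg f)%:E.
Proof.
move=> [B fB]; rewrite /avg fineK// fin_numE; apply/andP; split.
  rewrite gt_eqF// (@lt_le_trans _ _ 0%E) ?ltNy0// -(averaging_cst hE (lexx 0%E)).
  by apply: (averaging_le hE) => t _; rewrite lee_fin; case/andP: (fB t).
rewrite lt_eqF// (@le_lt_trans _ _ (Num.max B 0)%:E) ?ltry//.
rewrite -(@averaging_cst hE (Num.max B 0)%:E) ?lee_fin ?le_max ?lexx ?orbT//.
apply: (averaging_le hE) => t _; rewrite lee_fin le_max.
by case/andP: (fB t) => _ ->.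
Qed.

Lemma avg_cst a : 0 <= a -> avg (fun=> a) = a.
Proof. by move=> a0; rewrite /avg (averaging_cst hE)// lee_fin. Qed.

Lemma le_avg f g : bnn f -> bnn g -> (forall t, S t -> f t <= g t) -> avg f <= avg g.
Proof.
move=> bf bg fg; rewrite -lee_fin -!avgE//; apply: (averaging_le hE) => t /fg.
by rewrite lee_fin.
Qed.

Lemma eq_avg f g : bnn f -> bnn g -> (forall t, S t -> f t = g t) -> avg f = avg g.
Proof. by move=> bf bg fg; apply/eqP; rewrite eq_le !le_avg// => t /fg ->. Qed.

Lemma avg_ge0 f : bnn f -> 0 <= avg f.
Proof.
move=> bf; rewrite -(@avg_cst 0)//; apply: le_avg => //; first exact: bnn_cst.
by move=> t _; exact: bnn_ge0.
Qed.

Lemma avgD f g : bnn f -> bnn g -> avg (fun t => f t + g t) = avg f + avg g.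
Proof.
move=> bf bg; apply: EFin_inj; rewrite EFinD -!avgE//; last exact: bnnD.
by rewrite -(averagingD hE)// => t; rewrite lee_fin bnn_ge0.
Qed.

Lemma avgZ a f : 0 <= a -> bnn f -> avg (fun t => a * f t) = a * avg f.
Proof.
move=> a0 bf; apply: EFin_inj; rewrite EFinM -!avgE//; last exact: bnnZ.
by rewrite -(averagingZ hE)// => t; rewrite lee_fin bnn_ge0.
Qed.

Lemma avg_sum (I : Type) (r : seq I) (P : pred I) (F : I -> T -> R) :
  (forall i, bnn (F i)) ->
  avg (fun t => \sum_(i <- r | P i) F i t) = \sum_(i <- r | P i) avg (F i).
Proof.
move=> F0; have bs := bnn_sum _ _ F0; elim: r => [|i r IH].
  rewrite big_nil -[RHS]avg_cst//; apply: eq_avg => //;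
    last by move=> t _; rewrite big_nil.
  exact: bnn_cst.
rewrite big_cons -IH; case: ifPn => Pi; last first.
  by apply: eq_avg => // t _; rewrite big_cons (negbTE Pi).
rewrite -avgD//; apply: eq_avg => //; first exact: bnnD.
by move=> t _; rewrite big_cons Pi.
Qed.

End MeanFunctional.

(** * Decoding *)

Section Channels.
Variables (R : realType) (X Y : choiceType) (W : X -> Y -> R).
Hypothesis W_chan : is_channel W.

Lemma channel_ge0 x y : 0 <= W x y. Proof. by case: (W_chan x). Qed.

Lemma channel_le1 x y : W x y <= 1.
Proof.
rewrite -lee_fin -(W_chan x).2 /esumR (esumID [set y]); last first.
  by move=> ? _; rewrite lee_fin channel_ge0.
rewrite setTI esum_set1 ?lee_fin ?channel_ge0//.
by rewrite leeDl// esum_ge0// => ? _; rewrite lee_fin channel_ge0.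
Qed.

Lemma bnn_channel y : bnn (W^~ y).
Proof. by exists 1 => x; rewrite channel_ge0 channel_le1. Qed.

Lemma bnn_channel_powR y a : 0 <= a -> bnn (fun x => W x y `^ a).
Proof.
move=> a0; exists 1 => x; rewrite powR_ge0/=.
have -> : 1 = 1 `^ a :> R by rewrite powR1.
by apply: ge0_ler_powR; rewrite ?nnegrE ?channel_ge0 ?channel_le1 ?ler01.
Qed.

Lemma esum_channel_le1 (A : set Y) x : (\esum_(y in A) (W x y)%:E <= 1)%E.
Proof.
rewrite -(W_chan x).2 /esumR [leRHS](esumID A)// => [|y _];
  last by rewrite lee_fin channel_ge0.
by rewrite setTI leeDl// esum_ge0// => y _; rewrite lee_fin channel_ge0.
Qed.

Lemma sumR_channelE (A : set Y) x :
  (\esum_(y in A) (W x y)%:E)%E = (sumR A (W x))%:E.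
Proof.
rewrite /sumR fineK// ge0_fin_numE; last first.
  by apply: esum_ge0 => y _; rewrite lee_fin channel_ge0.
by rewrite (le_lt_trans (esum_channel_le1 A x))// ltry.
Qed.

Lemma bnn_sumR_channel (A : X -> set Y) : bnn (fun x => sumR (A x) (W x)).
Proof.
exists 1 => x; rewrite -!lee_fin -sumR_channelE esum_channel_le1 andbT.
by apply: esum_ge0 => y _; rewrite lee_fin channel_ge0.
Qed.

End Channels.

(** * First and second moments of a random code *)

Section RandomCode.
Variables (R : realType) (X : choiceType) (p : X -> R) (x0 : X) (K : finType).
Hypotheses (p_dist : is_pdist p) (px0 : 0 < p x0).

Let s := enum K.
Local Notation mx := (avg (Ex p)).
Local Notation mc := (avg (Ep p x0 s)).

Lemma Ex_averaging : averaging (fun x => 0 < p x) (Ex p).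
Proof.
split.
- exact: le_Ex.
- exact: ExD.
- exact: ExZ.
- exact: Ex_cst.
Qed.

Lemma Ep_averaging : averaging (supported p (K := K)) (Ep p x0 s).
Proof.
split.
- exact: le_Ep.
- exact: EpD.
- exact: EpZ.
- exact: Ep_cst.
Qed.

Lemma bnn_coord (f : X -> R) (k : K) : bnn f -> bnn (fun c : K -> X => f (c k)).
Proof. by move=> [B fB]; exists B. Qed.

Lemma avg_marginal (f : X -> R) (k : K) : bnn f -> mc (fun c => f (c k)) = mx f.
Proof.
move=> bf; rewrite /avg (Ep_marginal p_dist x0 (f := fun x => (f x)%:E))//.
- exact: enum_uniq.
- by rewrite mem_enum.
- by move=> x; rewrite lee_fin bnn_ge0.
Qed.

Lemma avg_marginal2 (f g : X -> R) (k l : K) : bnn f -> bnn g -> k != l ->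
  mc (fun c => f (c k) * g (c l)) = mx f * mx g.
Proof.
move=> bf bg kl.
rewrite {1}/avg (Ep_marginal2 p_dist x0 (h := fun x y => (f x * g y)%:E))//.
- rewrite (eq_Ex p_dist (g := fun x => (mx g)%:E * (f x)%:E)%E).
    rewrite (ExZ p_dist) ?(avg_ge0 Ex_averaging)//.
      by rewrite (avgE Ex_averaging)// -EFinM/= mulrC.
    by move=> x; rewrite lee_fin bnn_ge0.
  move=> x _; rewrite -(avgE Ex_averaging)//.
  rewrite muleC -(ExZ p_dist) ?bnn_ge0//.
  by move=> y; rewrite lee_fin bnn_ge0.
- exact: enum_uniq.
- by rewrite mem_enum.
- by rewrite mem_enum.
- by move=> x y; rewrite lee_fin mulr_ge0 ?bnn_ge0.
Qed.

Lemma bnn_coord2 (f g : X -> R) (k l : K) : bnn f -> bnn g ->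
  bnn (fun c : K -> X => f (c k) * g (c l)).
Proof. by move=> bf bg; apply: bnnM; exact: bnn_coord. Qed.

(** The n diagonal pairs keep the second moment; the n(n - 1) others involve distinct codewords, as
    [e] is injective, and factor by independence. *)
Lemma avg_double_sum n (e : 'I_n -> K) (f g : X -> R) : injective e ->
  bnn f -> bnn g ->
  mc (fun c => \sum_i \sum_j f (c (e i)) * g (c (e j))) =
  n%:R * mx (fun x => f x * g x) + n%:R * (n%:R - 1) * (mx f * mx g).
Proof.
move=> einj bf bg.
rewrite (avg_sum Ep_averaging); last first.
  by move=> i; apply: bnn_sum => j; exact: bnn_coord2.
transitivity (\sum_(i < n) (mx (fun x => f x * g x) + (n%:R - 1) * (mx f * mx g))).
  apply: eq_bigr => i _; rewrite (avg_sum Ep_averaging); last first.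
    by move=> j; exact: bnn_coord2.
  rewrite (bigD1 i)//= (avg_marginal (f := fun x => f x * g x)); last exact: bnnM.
  congr (_ + _).
  rewrite (eq_bigr (fun=> mx f * mx g)); last first.
    move=> j ji; rewrite avg_marginal2//; apply: contra ji => /eqP/einj ->.
    exact: eqxx.
  rewrite sumr_const cardC1 card_ord -[(mx f * mx g) *+ _]mulr_natl; congr (_ * _).
  by case: (n) i => [[]//|m] _; rewrite -natr1 addrK.
by rewrite sumr_const card_ord -[(_ + _) *+ _]mulr_natl mulrDr mulrA.
Qed.

(** * Average error of maximum-likelihood decoding *)

Section Decoding.
Variables (Y : choiceType) (W : X -> Y -> R).
Hypothesis W_chan : is_channel W.
Let N : R := #|K|%:R.

(* Pairwise error event of maximum-likelihood decoding: some other codeword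
   explains y at least as well as the k-th one. *)
Definition confusable (c : K -> X) (k : K) (y : Y) :=
  [exists k', (k' != k) && (W (c k) y <= W (c k') y)].

Definition confusion (k : K) (y : Y) (c : K -> X) : R :=
  if confusable c k y then W (c k) y else 0.

Lemma bnn_confusion k y : bnn (confusion k y).
Proof.
exact: (bnn_if (fun c => confusable c k y) (bnn_coord k (bnn_channel W_chan y))).
Qed.

Lemma avg_other_pairs_le (f g : X -> R) (k : K) : bnn f -> bnn g ->
  mc (fun c => \sum_(k' | k' != k) f (c k) * g (c k')) <= N * (mx f * mx g).
Proof.
move=> bf bg; rewrite (avg_sum Ep_averaging); last first.
  by move=> k'; exact: bnn_coord2.
rewrite (eq_bigr (fun=> mx f * mx g)); last first.
  by move=> k' kk'; rewrite avg_marginal2// eq_sym.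
rewrite sumr_const -[(mx f * mx g) *+ _]mulr_natl.
rewrite ler_wpM2r ?mulr_ge0 ?(avg_ge0 Ex_averaging)//.
by rewrite ler_nat max_card.
Qed.

(** Gallager's argument: with A = W^(1/(1+t)) one has W = A A^t, and under confusion A of the sent
    codeword is at most the sum S of A over the others, so W <= A S^t. The tangent of S^t leaves
    only products of two distinct codewords. *)
Lemma avg_confusion_gallager k y (t : R) : 0 <= t <= 1 ->
  mc (confusion k y) <= N `^ t * Epow W p t y `^ (1 + t).
Proof.
move=> /andP[t0 t1]; have t1p : 0 < 1 + t by lra.
have q0 : 0 <= 1 / (1 + t) by rewrite divr_ge0// ltW.
have q1 : 1 / (1 + t) <= 1 by rewrite ler_pdivrMr//; lra.
pose A x := W x y `^ (1 / (1 + t)).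
have bA : bnn A by exact: bnn_channel_powR.
have bW := bnn_channel W_chan y.
have A0 x : 0 <= A x by exact: bnn_ge0.
have aE : Epow W p t y = mx A by [].
have N0 : 0 < N by rewrite ltr0n; apply/card_gt0P; exists k.
(* A zero mean would make the tangent point 0, so it is treated apart: W <= 1 gives W <= A, and the
   mean of W vanishes too. *)
rewrite aE; have := avg_ge0 Ex_averaging bA; rewrite le_eqVlt => /predU1P[a0|a0].
  apply: (@le_trans _ _ 0); last by rewrite mulr_ge0 ?powR_ge0.
  rewrite a0; apply: (@le_trans _ _ (mx (W^~ y))).
    rewrite -(avg_marginal k bW); apply: (le_avg Ep_averaging).
    - exact: bnn_confusion.
    - exact: (bnn_coord k bW).
    - by move=> c _; rewrite /confusion; case: ifP => // _; exact: channel_ge0.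
  apply: (le_avg Ex_averaging) => // x _.
  have := channel_ge0 W_chan x y.
  rewrite le_eqVlt => /predU1P[<-|Wx]; first exact: powR_ge0.
  by apply: ger1_powR; rewrite ?q1// Wx channel_le1.
(* [b] dominates the mean of S, so averaging the tangent at [b] gives b^t ((1 - t) a + t a) = b^t
   a. *)
set a := mx A in a0 *; set b := N * a.
have b0 : 0 < b by rewrite mulr_gt0.
have WA x : W x y = A x * A x `^ t.
  rewrite -[in RHS](powRr1 (A0 x)) -powRrM mul1r -powRD; last first.
    by rewrite gt_eqF.
  by rewrite /A -powRrM divfK ?gt_eqF// powRr1// channel_ge0.
have bt0 : 0 <= b `^ t by exact: powR_ge0.
apply: (@le_trans _ _ (mc (fun c => b `^ t * (1 - t) * A (c k) +
    b `^ t * t / b * \sum_(k' | k' != k) A (c k) * A (c k')))).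
  apply: (le_avg Ep_averaging).
  - exact: bnn_confusion.
  - apply: bnnD; apply: bnnZ.
    + by rewrite mulr_ge0// subr_ge0.
    + exact: bnn_coord.
    + by rewrite divr_ge0 ?mulr_ge0// ltW.
    + by apply: bnn_sum => k'; exact: bnn_coord2.
  move=> c _; rewrite /confusion -mulr_sumr.
  set S := \sum_(k' | k' != k) A (c k').
  have S0 : 0 <= S by exact: sumr_ge0.
  have -> : b `^ t * (1 - t) * A (c k) + b `^ t * t / b * (A (c k) * S) =
      A (c k) * (b `^ t * (1 - t + t * (S / b))) by ring.
  have SB := powR_le_tangent S0 b0 (introT andP (conj t0 t1)).
  case: ifPn => [/existsP[k' /andP[kk' Wkk']]|_]; last first.
    by apply: mulr_ge0 => //; exact: le_trans (powR_ge0 _ _) SB.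
  rewrite WA; apply: ler_wpM2l => //; apply: le_trans SB; rewrite ge0_ler_powR ?nnegrE//.
  apply: (@le_trans _ _ (A (c k'))).
    by rewrite /A ge0_ler_powR ?nnegrE ?(channel_ge0 W_chan).
  by rewrite /S (bigD1 k')//= lerDl sumr_ge0.
rewrite (avgD Ep_averaging); last 2 first.
- apply: bnnZ; last exact: bnn_coord.
  by rewrite mulr_ge0// subr_ge0.
- apply: bnnZ; first by rewrite divr_ge0 ?mulr_ge0// ltW.
  by apply: bnn_sum => k'; exact: bnn_coord2.
rewrite !(avgZ Ep_averaging); last 4 first.
- by rewrite divr_ge0 ?mulr_ge0// ltW.
- by apply: bnn_sum => k'; exact: bnn_coord2.
- by rewrite mulr_ge0// subr_ge0.
- exact: bnn_coord.
rewrite avg_marginal//.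
apply: (@le_trans _ _ (b `^ t * (1 - t) * a + b `^ t * t / b * (N * (a * a)))).
  rewrite lerD2l ler_wpM2l//; first by rewrite divr_ge0 ?mulr_ge0// ltW.
  exact: avg_other_pairs_le.
rewrite powRD; last by rewrite gt_eqF.
rewrite powRr1 ?(ltW a0)//.
have -> : N `^ t * (a * a `^ t) = b `^ t * a.
  by rewrite /b powRM ?(ltW a0) ?(ltW N0)//; ring.
rewrite [N * (a * a)]mulrA -/b.
have -> : b `^ t * t / b * (b * a) = b `^ t * t * a by field; rewrite gt_eqF.
by rewrite -mulrDl -mulrDr subrK mulr1.
Qed.

(** When the sent codeword passes the threshold C w, so does the confusing one, and the indicator of
    confusion is at most the sum of W over the other codewords divided by C w. Independence then
    yields N w^2 / (C w). *)
Lemma avg_confusion_threshold k y (C : R) : 0 < C ->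
  mc (confusion k y) <=
    mx (fun x => if W x y / mixW W p y <= C then W x y else 0) + N / C * mixW W p y.
Proof.
move=> C0; have bW := bnn_channel W_chan y.
have wE : mixW W p y = mx (W^~ y) by [].
set w := mixW W p y in wE *.
have w0 : 0 <= w by rewrite wE (avg_ge0 Ex_averaging).
have cw0 : 0 <= (C * w)^-1 by rewrite invr_ge0 mulr_ge0// ltW.
pose T x := if W x y / w <= C then W x y else 0.
have bT : bnn T by exact: (bnn_if (fun x => W x y / w <= C)).
have bS : bnn (fun c : K -> X => \sum_(k' | k' != k) W (c k) y * W (c k') y).
  by apply: bnn_sum => k'; exact: (bnn_coord2 _ _ bW bW).
apply: (@le_trans _ _ (mc (fun c => T (c k) +
    (C * w)^-1 * \sum_(k' | k' != k) W (c k) y * W (c k') y))).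
  apply: (le_avg Ep_averaging).
  - exact: bnn_confusion.
  - by apply: bnnD; [exact: bnn_coord|exact: bnnZ].
  move=> c _; rewrite /confusion.
  have T0 : 0 <= T (c k) by exact: bnn_ge0.
  have S0 : 0 <= (C * w)^-1 * \sum_(k' | k' != k) W (c k) y * W (c k') y.
    by rewrite mulr_ge0//; exact: (bnn_ge0 _ bS).
  case: ifPn => [/existsP[k' /andP[kk' Wkk']]|_]; last by rewrite addr_ge0.
  rewrite /T; case: ifPn => [_|]; first by rewrite lerDl.
  rewrite -ltNge => CW; rewrite add0r.
  (* At w = 0 the quotient by w is 0 by convention, hence at most C, and the letter would fall under
     the other branch. *)
  have wp : 0 < w.
    rewrite lt_neqAle w0 andbT eq_sym; apply/eqP => w_eq0.
    by move: CW; rewrite w_eq0 invr0 mulr0 ltNge (ltW C0).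
  have Cw : 0 < C * w by rewrite mulr_gt0.
  move: CW; rewrite ltr_pdivlMr// => CW.
  rewrite -mulr_sumr mulrCA ler_peMr ?channel_ge0// ler_pdivlMl// mulr1.
  rewrite (bigD1 k')//= (le_trans (ltW CW))// (le_trans Wkk')// lerDl.
  by apply: sumr_ge0 => *; exact: channel_ge0.
rewrite (avgD Ep_averaging); last 2 first.
- exact: bnn_coord.
- exact: bnnZ.
rewrite avg_marginal// lerD2l (avgZ Ep_averaging)//.
apply: (@le_trans _ _ ((C * w)^-1 * (N * (w * w)))).
  by rewrite ler_wpM2l// avg_other_pairs_le.
rewrite invfM; have [->|wn0] := eqVneq w 0; first by rewrite !mulr0.
by rewrite le_eqVlt; apply/orP; left; apply/eqP; field; rewrite wn0 gt_eqF.
Qed.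

(** Ties and confusions between codewords of the same message count as errors, so this majorizes the
    error of the code while involving only pairs of codewords. *)
Definition decoding_error (c : K -> X) : \bar R :=
  \sum_k ((N^-1)%:E * \esum_(y in [set: Y]) (confusion k y c)%:E)%E.

Lemma confusion_ge0 k y c : (0 <= (confusion k y c)%:E :> \bar R)%E.
Proof. by rewrite lee_fin; exact: (bnn_ge0 _ (bnn_confusion k y)). Qed.

Lemma decoding_error_ge0 c : (0 <= decoding_error c)%E.
Proof.
apply: sume_ge0 => k _; rewrite mule_ge0 ?lee_fin ?invr_ge0//.
by apply: esum_ge0 => y _; exact: confusion_ge0.
Qed.

Lemma Ep_decoding_error_le (B : Y -> R) : (0 < #|K|)%N ->
  (forall k y, mc (confusion k y) <= B y) ->
  (Ep p x0 s decoding_error <= esumR setT B)%E.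
Proof.
move=> K0 hB; have NV : 0 <= N^-1 by rewrite invr_ge0.
have e0 k c : (0 <= \esum_(y in [set: Y]) (confusion k y c)%:E)%E.
  by apply: esum_ge0 => y _; exact: confusion_ge0.
rewrite (Ep_sum p_dist px0); last by move=> k c; rewrite mule_ge0 ?lee_fin.
apply: (@le_trans _ _ (\sum_(k in K) ((N^-1)%:E * esumR setT B))%E).
  apply: lee_sum => k _; rewrite (EpZ p_dist)//; apply: lee_wpmul2l => //.
  rewrite (Ep_esum p_dist); last by move=> y c; exact: confusion_ge0.
  apply: le_esum => y _; rewrite (avgE Ep_averaging) ?lee_fin//.
  exact: bnn_confusion.
rewrite -ge0_sume_distrl; last by move=> k _; rewrite lee_fin.
by rewrite sumEFin sumr_const -[(_^-1 *+ _)]mulr_natl divff ?mul1e// pnatr_eq0 -lt0n.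
Qed.

End Decoding.
End RandomCode.

(** * Resolvability of the eavesdropper's channel *)

Section Resolvability.
Variables (R : realType) (X : choiceType) (p : X -> R) (x0 : X) (K : finType).
Hypotheses (p_dist : is_pdist p) (px0 : 0 < p x0).
Variables (Z : finType) (W : X -> Z -> R) (L : nat) (e : 'I_L -> K).
Hypotheses (W_chan : is_channel W) (L_gt0 : (0 < L)%N) (e_inj : injective e).

Let s := enum K.
Local Notation mx := (avg (Ex p)).
Local Notation mc := (avg (Ep p x0 s)).
Local Notation exX := (Ex_averaging p_dist).
Local Notation exC := (Ep_averaging K p_dist px0).
Local Notation w := (mixW W p).

Let bW z : bnn (W^~ z). Proof. exact: bnn_channel. Qed.
Let W0 x z : 0 <= W x z. Proof. exact: channel_ge0. Qed.
Let LR : 0 < L%:R :> R. Proof. by rewrite ltr0n. Qed.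
Let LV : 0 < L%:R^-1 :> R. Proof. by rewrite invr_gt0. Qed.

Lemma avg_eq0 (f : X -> R) x : bnn f -> mx f = 0 -> 0 < p x -> f x = 0.
Proof.
move=> bf f0 px; apply: EFin_inj; apply: (Ex_le0 p_dist (f := fun y => (f y)%:E)) px.
  by move=> y; rewrite lee_fin bnn_ge0.
by rewrite (avgE exX)// f0.
Qed.

Lemma sum_channel x : \sum_z W x z = 1.
Proof.
apply: EFin_inj; rewrite -(W_chan x).2 /esumR esum_finType; last first.
  by move=> z; rewrite lee_fin.
by rewrite -sumEFin; apply: eq_bigl => z; rewrite in_setT.
Qed.

Lemma mixW_ge0 z : 0 <= w z. Proof. exact: (avg_ge0 exX (bW z)). Qed.

Lemma sum_mixW : \sum_z w z = 1.
Proof.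
transitivity (mx (fun x => \sum_z W x z)); first by rewrite (avg_sum exX).
rewrite -[RHS](avg_cst exX ler01); apply: (eq_avg exX).
- exact: bnn_sum.
- exact/bnn_cst/ler01.
- by move=> x _; rewrite sum_channel.
Qed.

Lemma mixW_le1 z : w z <= 1.
Proof.
rewrite -sum_mixW (bigD1 z)//= lerDl sumr_ge0// => *; exact: mixW_ge0.
Qed.

Lemma Z_gt0 : (0 < #|Z|)%N.
Proof.
rewrite lt0n; apply/eqP => /card0_eq Z0; have := sum_channel x0.
rewrite big_pred0 => [/eqP|z]; last by have := Z0 z; rewrite !inE.
by rewrite eq_sym oner_eq0.
Qed.

Definition empirical (c : K -> X) (z : Z) : R := L%:R^-1 * \sum_l W (c (e l)) z.
Local Notation V := empirical.

Lemma empirical_ge0 c z : 0 <= V c z.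
Proof. by rewrite mulr_ge0 ?(ltW LV)// sumr_ge0. Qed.

Lemma sum_empirical c : \sum_z V c z = 1.
Proof.
rewrite -mulr_sumr exchange_big/= (eq_bigr (fun=> 1)) => [|l _]; last exact: sum_channel.
by rewrite sumr_const card_ord mulVf// gt_eqF.
Qed.

Lemma empirical_le1 c z : V c z <= 1.
Proof.
rewrite -(sum_empirical c) (bigD1 z)//= lerDl sumr_ge0// => *; exact: empirical_ge0.
Qed.

Lemma empirical_eq0 c z : supported p c -> w z = 0 -> V c z = 0.
Proof.
move=> sc wz; rewrite /V big1 ?mulr0// => l _.
exact: (avg_eq0 (bW z) wz (sc _)).
Qed.

Lemma bnn_l1_term z : bnn (fun c => `|V c z - w z|).
Proof.
exists 1 => c; rewrite normr_ge0/= ler_norml.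
have := empirical_ge0 c z; have := empirical_le1 c z.
by have := mixW_ge0 z; have := mixW_le1 z; lra.
Qed.

Lemma bnn_average (f : X -> R) : bnn f ->
  bnn (fun c : K -> X => L%:R^-1 * \sum_l f (c (e l))).
Proof.
move=> bf; apply: bnnZ; first exact: ltW.
by apply: bnn_sum => l; exact: bnn_coord.
Qed.

Lemma avg_average (f : X -> R) : bnn f ->
  mc (fun c => L%:R^-1 * \sum_l f (c (e l))) = mx f.
Proof.
move=> bf; rewrite (avgZ exC) ?(ltW LV)//; last first.
  by apply: bnn_sum => l; exact: bnn_coord.
rewrite (avg_sum exC); last by move=> l; exact: bnn_coord.
rewrite (eq_bigr (fun=> mx f)) => [|l _]; last by rewrite (avg_marginal _ p_dist).
by rewrite sumr_const card_ord -[mx f *+ _]mulr_natl mulKf// gt_eqF.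
Qed.

Lemma bnn_pair_sum (f g : X -> R) : bnn f -> bnn g ->
  bnn (fun c : K -> X => \sum_l \sum_l' f (c (e l)) * g (c (e l'))).
Proof.
by move=> bf bg; apply: bnn_sum => l; apply: bnn_sum => l'; exact: bnn_coord2.
Qed.

(** Dividing by L^2 gives the diagonal weight 1/L, the origin of the 1/L in the threshold bounds;
    the weight 1 - 1/L of the other pairs is rounded up to 1. *)
Lemma avg_pair_sum_le (f g : X -> R) : bnn f -> bnn g ->
  (L%:R ^- 2) * mc (fun c => \sum_l \sum_l' f (c (e l)) * g (c (e l'))) <=
  L%:R^-1 * mx (fun x => f x * g x) + mx f * mx g.
Proof.
move=> bf bg; rewrite (avg_double_sum p_dist px0)//.
have -> : L%:R ^- 2 * (L%:R * mx (fun x => f x * g x) +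
    L%:R * (L%:R - 1) * (mx f * mx g)) =
    L%:R^-1 * mx (fun x => f x * g x) + mx f * mx g - L%:R^-1 * (mx f * mx g).
  by field; rewrite gt_eqF.
by rewrite gerBl mulr_ge0 ?(ltW LV)// mulr_ge0 ?(avg_ge0 exX).
Qed.

(** Summand of D(V||w) with the correction that makes it nonnegative. The value 0 at w(z) = 0 agrees
    with relative entropy on supported codes, where V(z) vanishes as well. *)
Definition divergence_term (z : Z) (c : K -> X) : R :=
  if 0 < w z then V c z * ln (V c z / w z) - V c z + w z else 0.

Lemma bnn_divergence_term z : bnn (divergence_term z).
Proof.
case wz : (0 < w z); last by exists 0 => c; rewrite /divergence_term wz lexx.
exists ((w z)^-1 + w z) => c; rewrite /divergence_term wz.
have V0 := empirical_ge0 c z; have V1 := empirical_le1 c z.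
rewrite relent_term_ge0//= lerD2r.
move: V0; rewrite le_eqVlt => /predU1P[<-|V0].
  by rewrite mul0r subr0 invr_ge0 ltW.
have wV : 0 < (w z)^-1 by rewrite invr_gt0.
have := ln_le_tangent (divr_gt0 V0 wz) ltr01; rewrite ln1 add0r divr1 => h.
have h1 := ler_wpM2l (ltW V0) h.
have h2 : V c z * (V c z / w z - 1) <= V c z * (V c z / w z).
  by rewrite mulrBr mulr1 gerBl ltW.
have h3 : V c z * (V c z / w z) <= (w z)^-1.
  by rewrite mulrA ler_piMl ?(ltW wV)// mulr_ile1// ltW.
by lra.
Qed.

(* Replacing ln by an affine majorant whose coefficients depend only on the
   codeword at hand makes the divergence a function of pairs of codewords. *)
Lemma avg_divergence_term_le z (al be ga : X -> R) : 0 < w z ->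
  bnn al -> bnn be -> bnn ga ->
  (forall x v, 0 < W x z -> 0 < v <= 1 ->
     ln (v / w z) <= al x + be x * (v / w z) - ga x) ->
  mc (divergence_term z) + mx (fun x => W x z * ga x) <=
  mx (fun x => W x z * al x) + mx (fun x => W x z * be x) +
  (L%:R * w z)^-1 * mx (fun x => W x z * be x * W x z).
Proof.
move=> wz bal bbe bga h.
have bWa := bnnM (bW z) bal; have bWb := bnnM (bW z) bbe; have bWg := bnnM (bW z) bga.
have wV : 0 <= (w z)^-1 by rewrite invr_ge0 ltW.
have LwV : 0 <= L%:R ^- 2 / w z by rewrite mulr_ge0// exprVn exprn_ge0// ltW.
have bg := bnn_divergence_term z.
have bP := bnn_pair_sum bWb (bW z).
(* The subtracted terms [V] and [ga] are added to the left, so that both sides are bounded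
   nonnegative functions. *)
have : mc (fun c => divergence_term z c +
      (V c z + L%:R^-1 * \sum_l W (c (e l)) z * ga (c (e l))))
    <= mc (fun c => L%:R^-1 * \sum_l W (c (e l)) z * al (c (e l)) +
        (L%:R ^- 2 / w z *
         (\sum_l \sum_l' W (c (e l)) z * be (c (e l)) * W (c (e l')) z) + w z)).
  apply: (le_avg exC).
  - by apply: bnnD => //; apply: bnnD;
      [exact: (bnn_average (bW z))|exact: (bnn_average bWg)].
  - apply: bnnD; first exact: (bnn_average bWa).
    by apply: bnnD; [exact: bnnZ|exact/bnn_cst/ltW].
  move=> c _; rewrite /divergence_term wz.
  have key : V c z * ln (V c z / w z) <= L%:R^-1 * \sum_l (W (c (e l)) z * al (c (e l)) +
      W (c (e l)) z * be (c (e l)) * (V c z / w z) - W (c (e l)) z * ga (c (e l))).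
    rewrite {1}/V -mulrA ler_pM2l// mulr_suml; apply: ler_sum => l _.
    have := W0 (c (e l)) z; rewrite le_eqVlt => /predU1P[<-|Wl].
      by rewrite !mul0r addr0 subr0.
    have V0 : 0 < V c z.
      by rewrite mulr_gt0// (bigD1 l)//= ltr_pwDl// sumr_ge0.
    rewrite -mulrA -mulrDr -mulrBr ler_pM2l//; apply: h => //.
    by rewrite V0 empirical_le1.
  have -> : L%:R ^- 2 / w z *
      (\sum_l \sum_l' W (c (e l)) z * be (c (e l)) * W (c (e l')) z) =
      L%:R^-1 * \sum_l W (c (e l)) z * be (c (e l)) * (V c z / w z).
    rewrite -mulr_suml; under eq_bigr do rewrite -mulr_sumr.
    by rewrite -mulr_suml /V; field; rewrite !gt_eqF.
  rewrite sumrB big_split/= in key.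
  by move: key; rewrite mulrBr mulrDr; lra.
rewrite (avgD exC bg); last first.
  by apply: bnnD; [exact: (bnn_average (bW z))|exact: (bnn_average bWg)].
rewrite (avgD exC (bnn_average (bW z)) (bnn_average bWg)).
rewrite (avgD exC (bnn_average bWa)); last first.
  by apply: bnnD; [exact: bnnZ|exact/bnn_cst/ltW].
rewrite (avgD exC (bnnZ LwV bP) (bnn_cst _ (ltW wz))).
rewrite (avgZ exC LwV bP) (avg_cst exC (ltW wz)).
rewrite (avg_average (bW z)) (avg_average bWg) (avg_average bWa).
have H := ler_wpM2l wV (avg_pair_sum_le bWb (bW z)).
rewrite -[mx (W^~ z)]/(w z) in H *.
set P := mc (fun c => \sum_l _) in H *.
set S2 := mx (fun x => W x z * be x * W x z) in H *.
set B := mx (fun x => W x z * be x) in H *.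
have e1 : L%:R ^- 2 / w z * P = (w z)^-1 * (L%:R ^- 2 * P) by ring.
have e2 : (w z)^-1 * (L%:R^-1 * S2 + B * w z) = (L%:R * w z)^-1 * S2 + B.
  by field; rewrite !gt_eqF.
by rewrite e2 in H; rewrite e1; lra.
Qed.

(** * Bounds by truncation of the likelihood ratio at [C] *)

Section Threshold.
Variable C : R.

Let U z x := if C * w z < W x z then W x z else 0.
Let T z x := if W x z <= C * w z then W x z else 0.

Let bU z : bnn (U z). Proof. exact: (bnn_if (fun x => C * w z < W x z)). Qed.
Let bT z : bnn (T z). Proof. exact: (bnn_if (fun x => W x z <= C * w z)). Qed.

Let WTU z x : W x z = T z x + U z x.
Proof. by rewrite /T /U; case: ltP => _; rewrite ?add0r ?addr0. Qed.

Let avgTU z : w z = mx (T z) + mx (U z).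
Proof.
rewrite -(avgD exX)// -[LHS]/(mx (W^~ z)); congr avg; apply/funext => x; exact: WTU.
Qed.

Lemma sumR_finType (A : set Z) (f : Z -> R) : (forall z, 0 <= f z) ->
  sumR A f = \sum_z if z \in A then f z else 0.
Proof.
move=> f0; rewrite /sumR /esumR esum_finType//.
by rewrite sumEFin/= big_mkcond.
Qed.

Lemma deltaE : delta p W C = \sum_z mx (U z).
Proof.
transitivity (mx (fun x => \sum_z U z x)); last by rewrite (avg_sum exX).
rewrite -[LHS]/(mx (fun x => sumR [set y | C * w y < W x y] (W x))).
congr avg; apply/funext => x; rewrite sumR_finType//; apply: eq_bigr => z _.
by rewrite mem_setE.
Qed.

Lemma delta'E : delta' p W C = \sum_z mx (fun x => T z x * T z x) / w z.
Proof.
transitivity (mx (fun x => \sum_z (w z)^-1 * (T z x * T z x))); last first.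
  rewrite (avg_sum exX); last first.
    by move=> z; apply: bnnZ; [rewrite invr_ge0 mixW_ge0|exact: bnnM].
  apply: eq_bigr => z _; rewrite (avgZ exX) ?invr_ge0 ?mixW_ge0//; last exact: bnnM.
  by rewrite mulrC.
rewrite -[LHS]/(mx (fun x => sumR [set y | W x y <= C * w y /\ 0 < w y]
  (fun y => W x y ^+ 2 / w y))).
congr avg; apply/funext => x; rewrite sumR_finType; last first.
  by move=> z; rewrite divr_ge0 ?mixW_ge0// exprn_ge0.
apply: eq_bigr => z _; case: ifPn => [|/negP]; rewrite inE /T.
  by move=> [-> _]; rewrite -expr2 mulrC.
have := mixW_ge0 z; rewrite le_eqVlt => /predU1P[<- _|wz h]; first by rewrite invr0 mul0r.
by case: ifPn => // Wz; [exfalso; apply: h|rewrite !mulr0].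
Qed.

Lemma delta'_ge0 : 0 <= delta' p W C.
Proof.
rewrite delta'E sumr_ge0// => z _; rewrite divr_ge0 ?mixW_ge0//.
by apply: (avg_ge0 exX); exact: bnnM.
Qed.

(** A codeword above the threshold is charged -ln w, since V <= 1; one below it is charged V/w - 1,
    the tangent of [ln] at 1. The first cost sums to an entropy of mass [delta], the second leaves
    only the diagonal term [delta']/L. *)
Lemma avg_divergence_threshold :
  mc (fun c => \sum_z divergence_term z c) <=
  eta_ent (delta p W C) + delta p W C * ln (#|Z|%:R) + delta' p W C / L%:R.
Proof.
rewrite (avg_sum exC); last exact: bnn_divergence_term.
apply: (@le_trans _ _ (\sum_z (mx (U z) * (- ln (w z)) +
    mx (fun x => T z x * T z x) / w z / L%:R))); last first.
  rewrite big_split/= -mulr_suml -delta'E lerD2r deltaE.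
  apply: sum_entropy_bound; first exact: Z_gt0.
  by move=> z; rewrite (avg_ge0 exX)// [w z]avgTU lerDr (avg_ge0 exX).
apply: ler_sum => z _.
have bTT : bnn (fun x => T z x * T z x) by exact: bnnM.
have := mixW_ge0 z; rewrite le_eqVlt => /predU1P[wz|wz].
  (* At w(z) = 0 the right side is 0 thanks to the conventions ln 0 = 0 and 1/0 = 0. *)
  rewrite -wz invr0 mulr0 mul0r addr0 ln0// oppr0 mulr0.
  rewrite -(@avg_cst _ _ _ _ exC 0)//; apply: (le_avg exC).
  - exact: bnn_divergence_term.
  - exact: bnn_cst.
  - by move=> c _; rewrite /divergence_term -wz ltxx.
have lw : 0 <= - ln (w z) by rewrite oppr_ge0 ln_le0// mixW_le1.
pose al x := if C * w z < W x z then - ln (w z) else 0.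
pose be x : R := if W x z <= C * w z then 1 else 0.
have bal : bnn al.
  by apply: (bnn_if (fun x => C * w z < W x z)); exact: bnn_cst.
have bbe : bnn be.
  by apply: (bnn_if (fun x => W x z <= C * w z)); exact/bnn_cst/ler01.
have /(avg_divergence_term_le wz bal bbe bbe) : forall x v, 0 < W x z -> 0 < v <= 1 ->
    ln (v / w z) <= al x + be x * (v / w z) - be x.
  move=> x v _ /andP[v0 v1]; rewrite /al /be; case: ltP => _.
    by rewrite mul0r addr0 subr0 ln_div ?posrE// gerDr ln_le0.
  rewrite add0r mul1r.
  by have := ln_le_tangent (divr_gt0 v0 wz) ltr01; rewrite ln1 add0r divr1.
have -> : mx (fun x => W x z * al x) = mx (U z) * (- ln (w z)).
  rewrite mulrC -(avgZ exX)//; congr avg; apply/funext => x.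
  by rewrite /al /U; case: ifP => _; rewrite ?mulr0// mulrC.
have -> : mx (fun x => W x z * be x * W x z) = mx (fun x => T z x * T z x).
  congr avg; apply/funext => x.
  by rewrite /be /T; case: ifP => _; rewrite ?mulr1 ?mulr0 ?mul0r.
rewrite invfM [L%:R^-1 * _]mulrC -mulrA [(w z)^-1 * _]mulrC [L%:R^-1 * _]mulrC.
by rewrite mulrAC; lra.
Qed.

(** The part of V above the threshold deviates from its mean by at most 2 E U on average; the part
    below it has variance at most E T^2 / L. *)
Lemma avg_l1_term_le z (k : R) : 0 < k ->
  mc (fun c => `|V c z - w z|) <= 2 * mx (U z) +
    mx (fun x => T z x * T z x) / w z / L%:R / (2 * k) + k * w z / 2.
Proof.
move=> k0; have bTT : bnn (fun x => T z x * T z x) by exact: bnnM.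
have s20 : 0 <= mx (fun x => T z x * T z x) by rewrite (avg_ge0 exX).
have a0 : 0 <= mx (U z) by rewrite (avg_ge0 exX).
have bN := bnn_l1_term z.
have := mixW_ge0 z; rewrite le_eqVlt => /predU1P[wz|wz].
  apply: (@le_trans _ _ (mc (fun=> 0))).
    apply: (le_avg exC) => //; first exact: bnn_cst.
    by move=> c sc; rewrite empirical_eq0// -?wz// subrr normr0.
  by rewrite (avg_cst exC)// -wz invr0 mulr0 !mul0r mulr0 mul0r !addr0 mulr_ge0.
(* A tangent point proportional to w(z) makes the terms b/2 sum to k/2 and the variances over 2b sum
   to [delta']/(2kL): Cauchy-Schwarz over z with weights w. *)
set b := k * w z; have b0 : 0 < b by rewrite mulr_gt0.
set t := mx (T z); have t0 : 0 <= t by rewrite (avg_ge0 exX).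
have bP := bnn_pair_sum (bT z) (bT z).
have tb : 0 <= t / b by rewrite divr_ge0// ltW.
have q0 : 0 <= (2 * b)^-1 * L%:R ^- 2.
  by rewrite mulr_ge0 ?invr_ge0 ?mulr_ge0 ?exprn_ge0// ?(ltW b0)// ltW.
have k0' : 0 <= mx (U z) + t ^+ 2 / (2 * b) + b / 2.
  have b2 : 0 <= (2 * b)^-1 by rewrite invr_ge0 mulr_ge0// ltW.
  by have := mulr_ge0 (exprn_ge0 2 t0) b2; lra.
have : mc (fun c => `|V c z - w z| + t / b * (L%:R^-1 * \sum_l T z (c (e l)))) <=
    mc (fun c => L%:R^-1 * \sum_l U z (c (e l)) +
      ((2 * b)^-1 * L%:R ^- 2 * (\sum_l \sum_l' T z (c (e l)) * T z (c (e l'))) +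
       (mx (U z) + t ^+ 2 / (2 * b) + b / 2))).
  apply: (le_avg exC).
  - by apply: bnnD => //; apply: bnnZ => //; exact: bnn_average.
  - apply: bnnD; first exact: bnn_average.
    by apply: bnnD; [exact: bnnZ|exact: bnn_cst].
  move=> c _.
  have -> : \sum_l \sum_l' T z (c (e l)) * T z (c (e l')) = (\sum_l T z (c (e l))) ^+ 2.
    by under eq_bigr do rewrite -mulr_sumr; rewrite -mulr_suml expr2.
  have VE : V c z = L%:R^-1 * \sum_l T z (c (e l)) + L%:R^-1 * \sum_l U z (c (e l)).
    by rewrite -mulrDr -big_split/=; congr (_ * _); apply: eq_bigr => l _; exact: WTU.
  set ST := \sum_l T z (c (e l)) in VE *.
  have SU0 : 0 <= L%:R^-1 * \sum_l U z (c (e l)).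
    by rewrite mulr_ge0 ?(ltW LV)// sumr_ge0// => l _; exact: bnn_ge0.
  set SU := L%:R^-1 * \sum_l U z (c (e l)) in VE SU0 *.
  have -> : V c z - w z = (L%:R^-1 * ST - t) + (SU - mx (U z)).
    by rewrite VE [w z]avgTU -/t; lra.
  have h1 := ler_normD (L%:R^-1 * ST - t) (SU - mx (U z)).
  have h2 : `|SU - mx (U z)| <= SU + mx (U z).
    by rewrite (le_trans (ler_normB _ _))// !ger0_norm.
  have h3 := normr_le_amgm (L%:R^-1 * ST - t) b0.
  have e3 : (L%:R^-1 * ST - t) ^+ 2 / (2 * b) = (2 * b)^-1 * L%:R ^- 2 * ST ^+ 2 -
      t / b * (L%:R^-1 * ST) + t ^+ 2 / (2 * b).
    by field; rewrite !gt_eqF.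
  by rewrite e3 in h3; lra.
rewrite (avgD exC bN (bnnZ tb (bnn_average (bT z)))).
rewrite (avgD exC (bnn_average (bU z)) (bnnD (bnnZ q0 bP) (bnn_cst _ k0'))).
rewrite (avgD exC (bnnZ q0 bP) (bnn_cst _ k0')) (avg_cst exC k0').
rewrite (avgZ exC tb (bnn_average (bT z))) (avgZ exC q0 bP).
rewrite !avg_average// -/t.
have q1 : 0 <= (2 * b)^-1 by rewrite invr_ge0 mulr_ge0// ltW.
have H := ler_wpM2l q1 (avg_pair_sum_le (bT z) (bT z)).
rewrite mulrA in H; move: H.
set S2 := mx (fun x => T z x * T z x); rewrite -/t.
have -> : (2 * b)^-1 * (L%:R^-1 * S2 + t * t) =
    S2 / w z / L%:R / (2 * k) + t ^+ 2 / (2 * b).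
  by rewrite /b; field; rewrite !gt_eqF.
have -> : t / b * t = t ^+ 2 / (2 * b) + t ^+ 2 / (2 * b).
  by field; rewrite gt_eqF.
by lra.
Qed.

Lemma avg_l1_le :
  mc (fun c => l1dist (V c) w) <= 2 * delta p W C + Num.sqrt (delta' p W C / L%:R).
Proof.
rewrite (avg_sum exC); last exact: bnn_l1_term.
have H k : 0 < k -> \sum_z mc (fun c => `|V c z - w z|) <=
    2 * delta p W C + delta' p W C / L%:R / (2 * k) + k / 2.
  move=> k0; apply: (le_trans (ler_sum _ (fun z _ => avg_l1_term_le z k0))).
  rewrite !big_split/= -mulr_sumr -deltaE -!mulr_suml -delta'E.
  by rewrite -mulr_sumr sum_mixW mulr1.
have d0 : 0 <= delta' p W C / L%:R by rewrite divr_ge0 ?delta'_ge0.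
set d' := delta' p W C / L%:R in d0 H *.
(* The optimal k is sqrt d'; for d' = 0 it degenerates, and arbitrarily small positive k are
   used. *)
move: d0; rewrite le_eqVlt => /predU1P[d0|d0].
  rewrite -d0 sqrtr0 addr0; apply/ler_addgt0Pr => ep ep0.
  have := H ep ep0; rewrite -d0 mul0r addr0 => /le_trans; apply.
  by rewrite lerD2l; lra.
have r0 : 0 < Num.sqrt d' by rewrite sqrtr_gt0.
apply: (le_trans (H _ r0)).
rewrite -{1}(sqr_sqrtr (ltW d0)).
have -> : Num.sqrt d' ^+ 2 / (2 * Num.sqrt d') = Num.sqrt d' / 2.
  by field; rewrite gt_eqF.
by lra.
Qed.

End Threshold.

(** Hölder with exponents 1/(1-r) and 1/r for A^(1-r) W^r, where A = W^(1/(1-r)); normalizing both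
    factors by their means turns it into the average of a pointwise AM-GM. *)
Lemma channel_hoelder z (r : R) : 0 < w z -> 0 < r < 1 ->
  mx (fun x => W x z * W x z `^ r) <= Epow W p (- r) z `^ (1 - r) * w z `^ r.
Proof.
move=> wz /andP[r0 r1]; have r1p : 0 < 1 - r by lra.
have q0 : 0 <= 1 / (1 - r) by rewrite divr_ge0// ltW.
pose A x := W x z `^ (1 / (1 - r)).
have bA : bnn A by exact: bnn_channel_powR.
have AW x : A x `^ (1 - r) = W x z by rewrite /A -powRrM divfK ?gt_eqF// powRr1.
rewrite -[Epow W p (- r) z]/(mx A).
have a0 : 0 < mx A.
  rewrite lt_neqAle (avg_ge0 exX)// andbT eq_sym; apply/eqP => /(avg_eq0 bA) Az.
  have : w z = 0.
    rewrite -[RHS](avg_cst exX (lexx 0)); apply: (eq_avg exX) => //.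
      exact: bnn_cst.
    by move=> x /Az; rewrite -AW => ->; rewrite powR0// gt_eqF.
  by move=> w_eq0; rewrite w_eq0 ltxx in wz.
set a := mx A in a0 *.
have D0 : 0 <= a `^ (1 - r) * w z `^ r by rewrite mulr_ge0 ?powR_ge0.
have c1 : 0 <= (1 - r) / a by rewrite divr_ge0// ltW.
have c2 : 0 <= r / w z by rewrite divr_ge0// ltW.
have bR : bnn (fun x => (1 - r) / a * A x + r / w z * W x z).
  by apply: bnnD; exact: bnnZ.
apply: (@le_trans _ _ (mx (fun x => a `^ (1 - r) * w z `^ r *
    ((1 - r) / a * A x + r / w z * W x z)))).
  apply: (le_avg exX).
  - by apply: bnnM => //; exact/bnn_channel_powR/ltW.
  - exact: bnnZ.
  move=> x _.
  have A0 : 0 <= A x by exact: bnn_ge0.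
  have h := @powR_amgm _ (W x z / w z) (A x / a) r
    (divr_ge0 (W0 x z) (ltW wz)) (divr_ge0 A0 (ltW a0)).
  have {}h := h ltac:(lra).
  have -> : W x z * W x z `^ r = a `^ (1 - r) * w z `^ r *
      ((W x z / w z) `^ r * (A x / a) `^ (1 - r)).
    have e1 : W x z `^ r = w z `^ r * (W x z / w z) `^ r.
      by rewrite -powRM ?divr_ge0 ?(ltW wz)// mulrC divfK// gt_eqF.
    have e2 : W x z = a `^ (1 - r) * (A x / a) `^ (1 - r).
      by rewrite -powRM ?divr_ge0 ?(ltW a0)// mulrC divfK ?gt_eqF// AW.
    by rewrite {1}e2 e1; ring.
  apply: ler_wpM2l => //; apply: le_trans h _.
  by rewrite le_eqVlt; apply/orP; left; apply/eqP; ring.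
rewrite (avgZ exX D0 bR) (avgD exX (bnnZ c1 bA) (bnnZ c2 (bW z))).
rewrite (avgZ exX c1 bA) (avgZ exX c2 (bW z)) -/a -[mx (W^~ z)]/(w z).
by rewrite !divfK ?gt_eqF// subrK mulr1.
Qed.

Lemma avg_divergence_term_exp z (r B : R) : 0 < r < 1 -> 1 <= B ->
  mc (divergence_term z) + r^-1 * w z <= r^-1 *
    (ln B * w z + (w z + L%:R `^ (- r) * Epow W p (- r) z `^ (1 - r)) / B).
Proof.
move=> r01 B1; have /andP[r0 r1] := r01.
have B0 : 0 < B by lra.
have lB : 0 <= ln B by exact: ln_ge0.
have rV : 0 <= r^-1 by rewrite invr_ge0 ltW.
have := mixW_ge0 z; rewrite le_eqVlt => /predU1P[wz|wz].
  have -> : mc (divergence_term z) = 0.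
    rewrite -[RHS](avg_cst exC (lexx 0)); congr avg; apply/funext => c.
    by rewrite /divergence_term -wz ltxx.
  rewrite -wz !mulr0 !add0r mulr_ge0// divr_ge0 ?(ltW B0)//.
  by rewrite mulr_ge0 ?powR_ge0.
have Lw : 0 < L%:R * w z by rewrite mulr_gt0.
(* Given that x is one of the L codewords, the mean of V/w is at most W_x/(L w) + 1 = 1 + u(x): this
   is the tangent point of [ln]. *)
pose u x := W x z / (L%:R * w z).
have u0 x : 0 <= u x by rewrite divr_ge0// ltW.
have bu : bnn u.
  exists (1 / (L%:R * w z)) => x; rewrite u0/= ler_pM2r ?invr_gt0//.
  exact: channel_le1.
have bln : bnn (fun x => ln (1 + u x)).
  have [D hD] := bu; exists D => x; have /andP[ux0 uxD] := hD x.
  rewrite ln_ge0/=; last by lra.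
  by apply: le_trans uxD; apply: le_ln1Dx; lra.
have bV1 : bnn (fun x => (1 + u x)^-1).
  exists 1 => x; have ux := u0 x; rewrite invr_ge0 invf_le1; lra.
have bu1 : bnn (fun x => u x `^ r).
  have [D hD] := bu; exists (D `^ r) => x; have /andP[ux0 uxD] := hD x.
  rewrite powR_ge0/= ge0_ler_powR ?nnegrE ?(ltW r0)//.
  exact: le_trans uxD.
have step1 : mc (divergence_term z) <= mx (fun x => W x z * ln (1 + u x)).
  have /(avg_divergence_term_le wz bln bV1 (bnn_cst _ ler01)) : forall x v,
      0 < W x z -> 0 < v <= 1 ->
      ln (v / w z) <= ln (1 + u x) + (1 + u x)^-1 * (v / w z) - 1.
    move=> x v _ /andP[v0 _]; have ux := u0 x.
    rewrite [_^-1 * _]mulrC; apply: ln_le_tangent; first exact: divr_gt0.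
    by lra.
  have -> : mx (fun x => W x z * 1) = w z.
    rewrite -[RHS]/(mx (W^~ z)); congr avg; apply/funext => x.
    by rewrite mulr1.
  have bb : bnn (fun x => W x z / (1 + u x)) by exact: bnnM.
  have LwV : 0 <= (L%:R * w z)^-1 by rewrite invr_ge0 ltW.
  rewrite -[_ * mx _](avgZ exX LwV (bnnM bb (bW z))) -addrA.
  rewrite -(avgD exX bb (bnnZ LwV (bnnM bb (bW z)))).
  (* With this tangent point the linear terms, diagonal included, collapse to w(z) and cancel the -1
     of the tangent. *)
  have -> : mx (fun x => W x z / (1 + u x) +
      (L%:R * w z)^-1 * (W x z / (1 + u x) * W x z)) = w z.
    rewrite -[RHS]/(mx (W^~ z)); congr avg; apply/funext => x.
    have ux : 1 + u x != 0 by rewrite gt_eqF//; have := u0 x; lra.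
    have -> : W x z / (1 + u x) + (L%:R * w z)^-1 * (W x z / (1 + u x) * W x z) =
      W x z * ((1 + u x) / (1 + u x)) by rewrite /u; ring.
    by rewrite divff// mulr1.
  by rewrite lerD2r.
have bWu := bnnM (bW z) bu1.
have step2 : mx (fun x => W x z * ln (1 + u x)) + r^-1 * w z <=
    r^-1 * (ln B * w z + (w z + mx (fun x => W x z * u x `^ r)) / B).
  have BV : 0 <= B^-1 by rewrite invr_ge0 ltW.
  rewrite -[w z]/(mx (W^~ z)) -(avgZ exX rV (bW z)).
  rewrite -(avgD exX (bnnM (bW z) bln) (bnnZ rV (bW z))).
  rewrite -(avgD exX (bW z) bWu) -(avgZ exX lB (bW z)) [_ / B]mulrC.
  rewrite -(avgZ exX BV (bnnD (bW z) bWu)).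
  have bE := bnnD (bnnZ lB (bW z)) (bnnZ BV (bnnD (bW z) bWu)).
  rewrite -(avgD exX (bnnZ lB (bW z)) (bnnZ BV (bnnD (bW z) bWu))).
  rewrite -(avgZ exX rV bE); apply: (le_avg exX).
  - exact: bnnD (bnnM (bW z) bln) (bnnZ rV (bW z)).
  - exact: bnnZ.
  move=> x _.
  have ur : 0 < 1 + u x `^ r by have := powR_ge0 (u x) r; lra.
  have h1 : ln (1 + u x) <= ln (1 + u x `^ r) / r.
    by apply: ln1D_le_powR => //; rewrite r0 ltW.
  have h2 := ln_le_tangent ur B0.
  have h3 : ln (1 + u x) <= r^-1 * (ln B + (1 + u x `^ r) / B - 1).
    by apply: le_trans h1 _; rewrite mulrC ler_wpM2l.
  have h4 := ler_wpM2l (W0 x z) h3.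
  have e4 : W x z * (r^-1 * (ln B + (1 + u x `^ r) / B - 1)) + r^-1 * W x z =
      r^-1 * (ln B * W x z + B^-1 * (W x z + W x z * u x `^ r)) by ring.
  by rewrite -e4 lerD2r.
have step3 : mx (fun x => W x z * u x `^ r) <=
    L%:R `^ (- r) * Epow W p (- r) z `^ (1 - r).
  have Lwr : 0 < (L%:R * w z) `^ r by exact: powR_gt0.
  have -> : mx (fun x => W x z * u x `^ r) =
      ((L%:R * w z) `^ r)^-1 * mx (fun x => W x z * W x z `^ r).
    rewrite -(avgZ exX); last 2 first.
    - by rewrite invr_ge0 ltW.
    - by apply: bnnM => //; exact/bnn_channel_powR/ltW.
    congr avg; apply/funext => x.
    have e1 : W x z `^ r = (L%:R * w z) `^ r * u x `^ r.
      by rewrite -powRM ?(ltW Lw)// /u mulrC divfK// gt_eqF.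
    by rewrite e1; field; rewrite gt_eqF.
  rewrite ler_pdivrMl// powRM ?(ltW wz) ?(ltW LR)// powRN.
  apply: le_trans (channel_hoelder wz r01) _.
  have Lr : 0 < L%:R `^ r :> R by exact: powR_gt0.
  by rewrite le_eqVlt; apply/orP; left; apply/eqP; field; rewrite gt_eqF.
apply: (le_trans (_ : _ <= mx (fun x => W x z * ln (1 + u x)) + r^-1 * w z)).
  by rewrite lerD2r.
apply: (le_trans step2); rewrite ler_wpM2l// lerD2l ler_pM2r ?invr_gt0//.
by rewrite lerD2l.
Qed.

Lemma avg_divergence_exp (t : R) : -(1/2) <= t < 0 ->
  mc (fun c => \sum_z divergence_term z c) <=
  ln (1 + L%:R `^ t * expR (phiW t W p)) / (- t).
Proof.
move=> /andP[t0 t1]; set r := - t.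
have tE : t = - r by rewrite opprK.
have r01 : 0 < r < 1 by rewrite /r; lra.
have r0 : 0 < r by case/andP: r01.
set G := \sum_z Epow W p t z `^ (1 + t).
have G0 : 0 <= G by apply: sumr_ge0 => z _; exact: powR_ge0.
have Lt : 0 <= L%:R `^ t :> R by exact: powR_ge0.
(* The second tangent of [ln] touches at the bound for the total mean of 1 + u^r over all z; its
   linear term becomes B/B = 1 and cancels against the r^-1 on the left. *)
set B := 1 + L%:R `^ t * G.
have B1 : 1 <= B by rewrite lerDl mulr_ge0.
have B0 : 0 < B by lra.
have rV : 0 <= r^-1 by rewrite invr_ge0 ltW.
apply: (@le_trans _ _ (ln B / r)); last first.
  (* Equality may fail at G = 0, where [ln] takes a default value; only this direction is used. *)
  have GE : G <= expR (phiW t W p).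
    rewrite /phiW -/G; move: G0; rewrite le_eqVlt => /predU1P[<-|G0].
      exact: expR_ge0.
    by rewrite lnK ?posrE.
  have E0 : 0 < 1 + L%:R `^ t * expR (phiW t W p).
    by rewrite ltr_pwDl// mulr_ge0// expR_ge0.
  by rewrite ler_pM2r ?invr_gt0// ler_ln ?posrE// lerD2l ler_wpM2l.
rewrite (avg_sum exC); last exact: bnn_divergence_term.
have H : \sum_z (mc (divergence_term z) + r^-1 * w z) <= \sum_z (r^-1 *
    (ln B * w z + (w z + L%:R `^ t * Epow W p t z `^ (1 + t)) / B)).
  by apply: ler_sum => z _; rewrite tE; exact: avg_divergence_term_exp.
move: H; rewrite big_split/= -!mulr_sumr sum_mixW big_split/= -mulr_sumr sum_mixW.
rewrite -mulr_suml big_split/= sum_mixW -mulr_sumr -/G -/B divff ?gt_eqF//.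
by lra.
Qed.

End Resolvability.

(** * Wire-tap codes *)

Section WiretapCode.
Variable R : realType.

Lemma pdist_support (X : choiceType) (p : X -> R) : is_pdist p -> exists x, 0 < p x.
Proof.
move=> p_dist.
have [||x [px _]] := @Ex_le_witness _ _ _ p_dist (fun=> 0%E) 0 => //.
  by rewrite (Ex_cst p_dist).
by exists x.
Qed.

(** Summing indicators counts repeated letters with multiplicity, since independent draws may
    coincide. *)
Definition empirical_dist (X : choiceType) n (d : 'I_n -> X) (x : X) : R :=
  n%:R^-1 * \sum_(l < n) (x == d l)%:R.

Lemma esumR_empirical_dist (X : choiceType) n (d : 'I_n -> X) (f : X -> R) :
  (forall x, 0 <= f x) ->
  esumR setT (fun x => empirical_dist d x * f x) = (n%:R^-1 * \sum_l f (d l))%:E.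
Proof.
move=> f0; have nV : 0 <= n%:R^-1 :> R by rewrite invr_ge0.
have g0 (x : X) (l : 'I_n) : (0 <= (n%:R^-1 * (x == d l)%:R * f x)%:E)%E.
  by rewrite lee_fin mulr_ge0// mulr_ge0.
transitivity (\esum_(x in [set: X]) \sum_(l < n) (n%:R^-1 * (x == d l)%:R * f x)%:E)%E.
  apply: eq_esum => x _; rewrite sumEFin; congr EFin.
  by rewrite /empirical_dist mulr_sumr mulr_suml.
rewrite esum_sum// mulr_sumr -sumEFin; apply: eq_bigr => l _.
rewrite (@esum_set1T _ _ (d l))// ?eqxx ?mulr1//.
by move=> x /negbTE ->; rewrite mulr0 mul0r.
Qed.

Lemma empirical_dist_pdist (X : choiceType) n (d : 'I_n -> X) : (0 < n)%N ->
  is_pdist (empirical_dist d).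
Proof.
move=> n0; split.
  by move=> x; rewrite mulr_ge0 ?invr_ge0// sumr_ge0.
transitivity (esumR setT (fun x => empirical_dist d x * 1)).
  by apply: eq_esum => x _; rewrite mulr1.
rewrite (@esumR_empirical_dist _ _ _ (fun=> 1))//; congr EFin.
by rewrite sumr_const card_ord mulVf// pnatr_eq0 -lt0n.
Qed.

Lemma mixW_empirical_dist (X Y : choiceType) (W : X -> Y -> R) n (d : 'I_n -> X) y :
  is_channel W ->
  mixW W (empirical_dist d) y = n%:R^-1 * \sum_l W (d l) y.
Proof.
move=> W_chan; rewrite /mixW /sumR (@esumR_empirical_dist _ _ _ (W^~ y))// => x.
exact: channel_ge0.
Qed.

Lemma fine_le_self (a : \bar R) : (0 <= a)%E -> ((fine a)%:E <= a)%E.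
Proof. by case: a. Qed.

(** * The maximum-likelihood decoder of a fixed code *)

Section MaximumLikelihood.
Variables (X Y : choiceType) (W : X -> Y -> R) (M L : nat).
Hypotheses (W_chan : is_channel W) (M_gt0 : (0 < M)%N) (L_gt0 : (0 < L)%N).
Let K := ('I_M * 'I_L)%type.
Variable c : K -> X.

(** The maximum runs over message and randomization index together, so that a wrong message always
    exhibits a competing codeword; [ml_region] then forgets the second index. *)
Definition ml_codeword (y : Y) : K :=
  [arg max_(k > (Ordinal M_gt0, Ordinal L_gt0)) W (c k) y]%O.

Definition ml_region (i : 'I_M) : set Y := [set y | (ml_codeword y).1 = i].

Lemma ml_region_disjoint i j : i != j -> ml_region i `&` ml_region j = set0.
Proof.
by move=> ij; apply/seteqP; split => // y [h1 h2]; rewrite -h1 -h2 eqxx in ij.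
Qed.

Lemma confusable_ml i l y : ~ ml_region i y -> confusable W c (i, l) y.
Proof.
move=> yD; apply/existsP; exists (ml_codeword y); apply/andP; split.
  by apply/eqP => h; apply: yD; rewrite /ml_region/= h.
by rewrite /ml_codeword; case: arg_maxP => //= k _; exact.
Qed.

Lemma epsB_le_decoding_error :
  ((epsB W (fun i => empirical_dist (fun l => c (i, l))) ml_region)%:E <=
   decoding_error W c)%E.
Proof.
have cf0 k y : (0 <= (confusion W k y c)%:E)%E by exact: confusion_ge0.
have MV : 0 <= M%:R^-1 :> R by rewrite invr_ge0.
have LV : 0 <= L%:R^-1 :> R by rewrite invr_ge0.
rewrite /epsB EFinM -sumEFin ge0_sume_distrr; last first.
  move=> i _; rewrite lee_fin fine_ge0// esum_ge0// => y _.
  rewrite lee_fin mixW_empirical_dist// mulr_ge0// sumr_ge0// => l _.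
  exact: channel_ge0.
have -> : decoding_error W c = (\sum_(i < M) \sum_(l < L) ((#|{: K}|%:R^-1)%:E *
    \esum_(y in [set: Y]) (confusion W (i, l) y c)%:E))%E.
  by rewrite /decoding_error pair_bigA/=; apply: eq_bigr => -[i l] _.
apply: lee_sum => i _; rewrite card_prod !card_ord natrM invfM EFinM.
under eq_bigr do rewrite -muleA.
rewrite -ge0_sume_distrr; last first.
  by move=> l _; rewrite mule_ge0 ?lee_fin// esum_ge0.
apply: lee_wpmul2l; first by rewrite lee_fin.
have e0 y : (0 <= (mixW W (empirical_dist (fun l => c (i, l))) y)%:E)%E.
  rewrite lee_fin mixW_empirical_dist// mulr_ge0// sumr_ge0// => l _.
  exact: channel_ge0.
apply: (le_trans (fine_le_self _)); first exact: esum_ge0.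
rewrite /esumR (eq_esum (b := fun y => \sum_(l < L)
  ((L%:R^-1)%:E * (W (c (i, l)) y)%:E)%E)); last first.
  move=> y _; rewrite mixW_empirical_dist// mulr_sumr -sumEFin.
  by apply: eq_bigr => l _; rewrite EFinM.
rewrite esum_sum; last first.
  by move=> y l _ _; rewrite mule_ge0 ?lee_fin// channel_ge0.
apply: lee_sum => l _; rewrite esumZl//; last first.
  by move=> y; rewrite lee_fin channel_ge0.
apply: lee_wpmul2l; first by rewrite lee_fin.
rewrite esum_mkcond; apply: le_esum => y _; case: ifPn => [|_]; last exact: cf0.
by rewrite inE /confusion => /confusable_ml ->.
Qed.

End MaximumLikelihood.

Lemma l1dist_triangle (Z : finType) (q r w : Z -> R) :
  l1dist q r <= l1dist q w + l1dist r w.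
Proof.
rewrite /l1dist -big_split/=; apply: ler_sum => z _.
by rewrite [`|r z - w z|]distrC (le_trans _ (ler_normD _ _))// addrA subrK.
Qed.

Lemma l1dist_ge0 (Z : finType) (q r : Z -> R) : 0 <= l1dist q r.
Proof. exact: sumr_ge0. Qed.

Lemma sum_offdiag n (a : 'I_n -> R) :
  \sum_(i < n) \sum_(j < n | i != j) (a i + a j) = 2 * (n%:R - 1) * \sum_i a i.
Proof.
have offdiag (b : 'I_n -> 'I_n -> R) i :
    \sum_(j < n | i != j) b i j = \sum_j b i j - b i i.
  rewrite [X in X - _](bigD1 i)//= addrAC subrr add0r.
  by apply: eq_bigl => j; rewrite eq_sym.
under eq_bigr do rewrite (offdiag (fun i j => a i + a j)) big_split/= sumr_const card_ord.
rewrite sumrB !big_split/= sumr_const card_ord sumrMnl.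
rewrite -[(\sum_i a i) *+ n]mulr_natl; ring.
Qed.

(** Each message occurs in 2(M - 1) ordered off-diagonal pairs, which turns the normalization 1/(M(M
    - 1)) into 2/M. *)
Lemma dE_le (X : choiceType) (Z : finType) (W : X -> Z -> R) M
    (Q : 'I_M -> X -> R) (w : Z -> R) :
  dE W Q <= 2 * (M%:R^-1 * \sum_i l1dist (mixW W (Q i)) w).
Proof.
set a := fun i => l1dist (mixW W (Q i)) w.
have a0 : 0 <= \sum_i a i by apply: sumr_ge0 => i _; exact: l1dist_ge0.
have RHS0 : 0 <= 2 * (M%:R^-1 * \sum_i a i) by rewrite !mulr_ge0.
(* For M <= 1 the normalization is the inverse of 0, so [dE] is 0. *)
have [M1|M1] := leqP M 1.
  rewrite /dE (_ : (M * (M - 1))%N = 0%N) ?invr0 ?mul0r//.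
  by move/eqP: M1 => ->; rewrite muln0.
have MR : 1 < M%:R :> R by rewrite ltr1n.
apply: (@le_trans _ _ (((M * (M - 1))%:R)^-1 *
    \sum_(i < M) \sum_(j < M | i != j) (a i + a j))).
  rewrite ler_wpM2l ?invr_ge0//; apply: ler_sum => i _; apply: ler_sum => j _.
  exact: l1dist_triangle.
rewrite sum_offdiag natrM natrB ?(ltnW M1)// le_eqVlt; apply/orP; left; apply/eqP.
by field; apply/andP; split; rewrite gt_eqF//; lra.
Qed.

Lemma relent_empirical (X : choiceType) (p : X -> R) (K : finType) (Z : finType)
    (W : X -> Z -> R) L (e : 'I_L -> K) (c : K -> X) :
  is_pdist p -> is_channel W -> (0 < L)%N -> supported p c ->
  relent (empirical W e c) (mixW W p) = \sum_z divergence_term p W e z c.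
Proof.
move=> p_dist W_chan L0 sc; set w := mixW W p.
transitivity (\sum_z (empirical W e c z * ln (empirical W e c z / w z) -
    empirical W e c z + w z)).
  by rewrite big_split/= sumrB sum_empirical// sum_mixW// subrK.
apply: eq_bigr => z _; rewrite /divergence_term -/w.
have := mixW_ge0 p_dist W_chan z; rewrite -/w le_eqVlt => /predU1P[wz|->//].
by rewrite (empirical_eq0 p_dist)// -?wz// ltxx mul0r subrr addr0.
Qed.

Lemma esumR_threshold (X Y : choiceType) (p : X -> R) (W : X -> Y -> R) (C N : R) :
  is_pdist p -> is_channel W -> 0 <= N ->
  (esumR setT (fun y => avg (Ex p) (fun x =>
      if W x y / mixW W p y <= C then W x y else 0)%R + N * mixW W p y)%R =
   (sumR setT (fun x => p x * sumR [set y | W x y / mixW W p y <= C] (W x)) + N)%:E)%E.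
Proof.
move=> p_dist W_chan N0; have exX := Ex_averaging p_dist.
have W0 x y : (0 <= (W x y)%:E)%E by rewrite lee_fin channel_ge0.
have bT y : bnn (fun x => if W x y / mixW W p y <= C then W x y else 0).
  apply: (bnn_if (fun x => W x y / mixW W p y <= C)); exact: bnn_channel.
have w0 y : 0 <= mixW W p y by exact: (avg_ge0 exX (bnn_channel W_chan y)).
rewrite /esumR; under eq_esum do rewrite EFinD EFinM.
rewrite esumD; last 2 first.
- by move=> y _; rewrite lee_fin (avg_ge0 exX).
- by move=> y _; rewrite -EFinM lee_fin mulr_ge0.
rewrite esumZl// [RHS]EFinD; congr (_ + _)%E.
- rewrite (eq_esum (b := fun y => Ex p (fun x =>
      (if W x y / mixW W p y <= C then W x y else 0)%:E))); last first.
    by move=> y _; rewrite -(avgE exX).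
  rewrite -(Ex_esum p_dist); last first.
    by move=> y x; rewrite lee_fin; exact: (bnn_ge0 _ (bT y)).
  rewrite -[X in X%:E]/(avg (Ex p) (fun x =>
    sumR [set y | W x y / mixW W p y <= C] (W x))).
  rewrite -(avgE exX); last first.
    exact: (bnn_sumR_channel W_chan (fun x => [set y | W x y / mixW W p y <= C])).
  apply: (eq_Ex p_dist) => x _; rewrite -(sumR_channelE W_chan) [RHS]esum_mkcond.
  apply: eq_esum => y _; case: ifPn => [h|/negP h]; first by rewrite mem_set.
  by rewrite memNset.
- rewrite (eq_esum (b := fun y => Ex p (fun x => (W x y)%:E))); last first.
    by move=> y _; rewrite (avgE exX)//; exact: bnn_channel.
  rewrite -(Ex_esum p_dist)//.
  rewrite (eq_Ex p_dist (g := fun=> 1%E)); last by move=> x _; exact: (W_chan x).2.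
  by rewrite (Ex_cst p_dist)// mule1.
Qed.

End WiretapCode.

Unset Implicit Arguments.

Theorem theorem3 (R : realType) (X Y : countType) (Z : finType)
  (WB : X -> Y -> R) (WE : X -> Z -> R)
  (hWB : is_channel WB) (hWE : is_channel WE)
  (L M : nat) (hL : (0 < L)%N) (hM : (0 < M)%N)
  (C C' : R) (hC : 0 < C) (hC' : 0 < C')
  (p : X -> R) (hp : is_pdist p) :
  exists (Q : 'I_M -> X -> R) (D : 'I_M -> set Y),
    (forall i, is_pdist (Q i)) /\
    (forall i j, i != j -> D i `&` D j = set0) /\
    (forall s : R, 0 <= s <= 1 ->
       ((epsB WB Q D)%:E <= (3 * powR (M * L)%:R s)%:E * gallager_sum WB p s)%E) /\
    epsB WB Q D <=
      3 * (sumR setT (fun x => p x *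
                 sumR [set y | WB x y / mixW WB p y <= C'] (WB x))
           + (M * L)%:R / C') /\
    IE WE Q <=
      3 * (eta_ent (delta p WE C) + delta p WE C * ln (#|Z|%:R)
           + delta' p WE C / L%:R) /\
    (forall t : R, -(1/2) <= t < 0 ->
       IE WE Q <= 3 * (ln (1 + powR L%:R t * expR (phiW t WE p)) / (- t))) /\
    dE WE Q <= 6 * (2 * delta p WE C + Num.sqrt (delta' p WE C / L%:R)).
Proof.
have [x0 px0] := pdist_support hp.
pose K : finType := ('I_M * 'I_L)%type.
pose e (i : 'I_M) (l : 'I_L) : K := (i, l).
have e_inj i : injective (e i) by move=> l l' [].
have exC := Ep_averaging K hp px0.
have NE : #|K|%:R = (M * L)%:R :> R by rewrite card_prod !card_ord.
have MR : 0 < M%:R :> R by rewrite ltr0n.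
have MV : 0 <= M%:R^-1 :> R by rewrite invr_ge0.
pose kl (c : K -> X) := M%:R^-1 * \sum_(i < M) \sum_z divergence_term p WE (e i) z c.
pose l1 (c : K -> X) := M%:R^-1 * \sum_(i < M) l1dist (empirical WE (e i) c) (mixW WE p).
have bkl i : bnn (fun c => \sum_z divergence_term p WE (e i) z c).
  by apply: bnn_sum => z; exact: bnn_divergence_term.
have bl1 i : bnn (fun c => l1dist (empirical WE (e i) c) (mixW WE p)).
  by apply: bnn_sum => z; exact: bnn_l1_term.
have avgM (F : 'I_M -> (K -> X) -> R) B : (forall i, bnn (F i)) ->
    (forall i, avg (Ep p x0 (enum K)) (F i) <= B) ->
    (Ep p x0 (enum K) (fun c => (M%:R^-1 * \sum_i F i c)%:E) <= B%:E)%E.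
  move=> bF FB; rewrite (avgE exC); last by apply: bnnZ => //; exact: bnn_sum.
  rewrite lee_fin (avgZ exC) ?(avg_sum exC)//; last exact: bnn_sum.
  rewrite ler_pdivrMl// (le_trans (ler_sum _ (fun i _ => FB i)))//.
  by rewrite sumr_const card_ord -[B *+ M]mulr_natl.
(* Divergence and distance are averaged over the messages before Markov's inequality is applied;
   this keeps the factor at 3, independent of M. *)
pose F (j : 'I_3) (c : K -> X) : \bar R :=
  if val j == 0%N then decoding_error WB c
  else if val j == 1%N then (kl c)%:E else (l1 c)%:E.
have F0 j c : (0 <= F j c)%E.
  rewrite /F; case: ifP => _; first exact: decoding_error_ge0.
  case: ifP => _; rewrite lee_fin mulr_ge0// sumr_ge0// => i _.
    exact: (bnn_ge0 _ (bkl i)).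
  exact: (bnn_ge0 _ (bl1 i)).
(* The code is fixed here, before [s] and [t] are introduced, so it serves all their values at once
   and attains both minima. *)
have [c sc Fc] := markov_simultaneous hp px0 (enum K) (isT : (0 < 3)%N) F0.
have := Fc (@Ordinal 3 0 isT); have := Fc (@Ordinal 3 1 isT).
have := Fc (@Ordinal 3 2 isT); rewrite /F/= => {Fc F F0} Fl1 Fkl Fdec.
pose Q i : X -> R := empirical_dist R (fun l => c (i, l)).
have VQ i : mixW WE (Q i) = empirical WE (e i) c.
  by apply/funext => z; rewrite mixW_empirical_dist.
exists Q, (ml_region WB hM hL c); split.
  by move=> i; exact: empirical_dist_pdist.
split; first exact: ml_region_disjoint.
have eps_le B : (forall k y, avg (Ep p x0 (enum K)) (confusion WB k y) <= B y) ->
    ((epsB WB Q (ml_region WB hM hL c))%:E <= 3%:E * esumR setT B)%E.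
  move=> hB; apply: (le_trans (epsB_le_decoding_error hWB hM hL c)).
  apply: (le_trans Fdec); apply: lee_wpmul2l => //.
  apply: (Ep_decoding_error_le hp px0 hWB) => //.
  by rewrite card_prod !card_ord muln_gt0 hM.
have kl_le B : (forall i, avg (Ep p x0 (enum K))
      (fun c => \sum_z divergence_term p WE (e i) z c) <= B) -> IE WE Q <= 3 * B.
  move=> hB; rewrite -lee_fin [(3 * _)%:E]EFinM.
  apply: le_trans (_ : _ <= (kl c)%:E)%E _; last first.
    by apply: (le_trans Fkl); apply: lee_wpmul2l => //; exact: avgM.
  rewrite lee_fin /kl mulr_sumr /IE; under [leRHS]eq_bigr do
    rewrite -(relent_empirical _ hp hWE hL sc) -VQ.
  apply: (@relent_mixture_le _ _ _ (fun i => mixW WE (Q i))) => //.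
  - by move=> i z; rewrite VQ empirical_ge0.
  - by move=> i; rewrite VQ sum_empirical.
  - exact: mixW_ge0.
  - exact: sum_mixW.
  - by move=> i z; rewrite VQ; exact: empirical_eq0.
split.
  move=> t t01; rewrite [(3 * _)%:E]EFinM -muleA.
  apply: le_trans (eps_le (fun y => (M * L)%:R `^ t * Epow WB p t y `^ (1 + t)) _) _.
    by move=> k y; rewrite -NE; exact: avg_confusion_gallager.
  apply: lee_wpmul2l => //; rewrite /gallager_sum /esumR -esumZl ?powR_ge0//.
  by move=> y; rewrite lee_fin powR_ge0.
split.
  rewrite -lee_fin [(3 * _)%:E]EFinM -esumR_threshold//; last by rewrite divr_ge0// ltW.
  by apply: eps_le => k y; rewrite -NE; exact: avg_confusion_threshold.
split; first by apply: kl_le => i; exact: avg_divergence_threshold.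
split; first by move=> t t0; apply: kl_le => i; exact: avg_divergence_exp.
apply: (le_trans (dE_le WE Q (mixW WE p))).
under eq_bigr do rewrite VQ.
have -> : 6 = 2 * 3 :> R by rewrite -natrM.
rewrite -mulrA ler_pM2l// -lee_fin [(3 * _)%:E]EFinM.
apply: (le_trans Fl1); apply: lee_wpmul2l => //.
by apply: avgM => // i; exact: avg_l1_le.
Qed.
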